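(* Let $\kappa,\tau,H\in\mathbb{R}$ and let $\Gamma\subset\mathbb{E}(\kappa,\tau)$ be a horizontal geodesic. If $4H^2+\kappa\leq 0$, then there are no $H$-surfaces properly immersed in $\mathbb{E}(\kappa,\tau)$ at bounded distance from $\Gamma$.
   Context: $\mathbb{E}(\kappa,\tau)$ is the unique simply connected oriented Riemannian 3-manifold admitting a Riemannian submersion $\pi:\mathbb{E}(\kappa,\tau)\to\mathbb{M}^2(\kappa)$ onto the complete simply connected surface of constant curvature $\kappa$ whose fibers are the integral curves of a complete unit Killing field $\xi$ satisfying $\overline\nabla_X\xi=\tau\,X\times\xi$ for all $X$ (constant bundle curvature $\tau$). A geodesic is horizontal if it is everywhere orthogonal to $\xi$. An $H$-surface is an immersed surface (without boundary) of constant mean curvature $H$, where the mean curvature is half of the trace of the shape operator. ''At bounded distance from $\Gamma$'' means that the distance in $\mathbb{E}(\kappa,\tau)$ to $\Gamma$ is a bounded function on the surface. *)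

(* Defs.v *)
From HB Require Import structures.
From mathcomp Require Import all_boot all_order all_algebra.
From mathcomp Require Import all_classical all_reals all_analysis.
From mathcomp Require Import ring lra.

Set Implicit Arguments.
Unset Strict Implicit.
Unset Printing Implicit Defensive.

Import Order.TTheory GRing.Theory Num.Theory.
Import numFieldNormedType.Exports.
Local Open Scope classical_set_scope.
Local Open Scope ring_scope.

Section Smooth.
Variable R : realType.

Definition partial (n : nat) (V : normedModType R) (i : 'I_n.+1)
    (f : 'rV[R]_n.+1 -> V) (x : 'rV[R]_n.+1) : V :=
  'D_(delta_mx 0 i) f x.

Definition iter_partial (n : nat) (V : normedModType R) (s : seq 'I_n.+1)
    (f : 'rV[R]_n.+1 -> V) : 'rV[R]_n.+1 -> V :=
  foldr (@partial n V) f s.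

(* On an open set this is C^oo: a differentiable iterated partial derivative
   is in particular continuous. *)
Definition smooth_on (n : nat) (V : normedModType R) (U : set 'rV[R]_n.+1)
    (f : 'rV[R]_n.+1 -> V) : Prop :=
  open U /\ forall s x, U x -> differentiable (iter_partial s f) x.

End Smooth.

(* Riemannian geometry of an open subset of R^(n+1), the metric being given by
   its Gram matrices in the standard coordinates. *)
Section Riemannian.
Variables (R : realType) (n : nat).
Implicit Types (g : 'rV[R]_n.+1 -> 'M[R]_n.+1) (p v w : 'rV[R]_n.+1).
Implicit Types (E : set 'rV[R]_n.+1) (c : R -> 'rV[R]_n.+1).

Definition inner g p v w : R := (v *m g p *m w^T) 0 0.

Definition christoffel g (i j k : 'I_n.+1) p : R :=
  2^-1 * \sum_l invmx (g p) k l *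
    (partial i (fun q => g q j l) p
     + partial j (fun q => g q i l) p
     - partial l (fun q => g q i j) p).

(* The zeroth-order part of the Levi-Civita connection: the covariant
   derivative of W in the direction v is 'D_v W + connection g p v (W p). *)
Definition connection g p v w : 'rV[R]_n.+1 :=
  \row_k \sum_i \sum_j christoffel g i j k p * v 0 i * w 0 j.

Definition geodesic E g c : Prop :=
  [/\ forall t, E (c t),
      forall m t, derivable (derive1n m c) t 1,
      forall t, derive1 c t != 0 &
      forall t, derive1n 2 c t
                + connection g (c t) (derive1 c t) (derive1 c t) = 0].

Definition C1_arc E c : Prop :=
  forall t, t \in `[0, 1] ->
    [/\ E (c t), derivable c t 1 & {for t, continuous (derive1 c)}].

Definition arc_length g c : R :=
  \int[lebesgue_measure]_(t in `[0, 1])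
    Num.sqrt (inner g (c t) (derive1 c t) (derive1 c t)).

(* [path_of_length E g p q l]: some piecewise C^1 curve in E from p to q has
   length l. *)
Inductive path_of_length E g : 'rV[R]_n.+1 -> 'rV[R]_n.+1 -> R -> Prop :=
| path_nil p : E p -> path_of_length E g p p 0
| path_cons c q l : C1_arc E c -> path_of_length E g (c 1) q l ->
    path_of_length E g (c 0) q (arc_length g c + l).

Definition riemannian_dist E g p q : \bar R :=
  ereal_inf [set l%:E | l in [set l | path_of_length E g p q l]].

Definition dist_to_set E g (A : set 'rV[R]_n.+1) p : \bar R :=
  ereal_inf [set riemannian_dist E g p q | q in A].

End Riemannian.

(* Cartan's model of E(kappa, tau): the points (x, y, z) with
   1 + kappa / 4 (x^2 + y^2) > 0, with the metric
     lambda^2 (dx^2 + dy^2) + (dz + tau lambda (y dx - x dy))^2,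
   lambda = 1 / (1 + kappa / 4 (x^2 + y^2)), the projection (x, y, z) |-> (x, y)
   and xi = d/dz.  The base with lambda^2 (dx^2 + dy^2) is the Euclidean plane
   (kappa = 0) or the hyperbolic plane of curvature kappa (kappa < 0), so that
   the model is the whole of E(kappa, tau) for kappa <= 0.  For kappa > 0 it
   is the universal cover of E(kappa, tau) minus one fibre, and not complete. *)
Section Ekt.
Variables (R : realType) (kappa tau : R).
Implicit Types p v w : 'rV[R]_3.

Definition Ekt_denom p : R := 1 + kappa / 4 * (p 0 0 ^+ 2 + p 0 1 ^+ 2).

Definition Ekt : set 'rV[R]_3 := [set p | 0 < Ekt_denom p].

Definition Ekt_lambda p : R := (Ekt_denom p)^-1.

Definition Ekt_eta p : 'rV[R]_3 :=
  \row_i [:: tau * Ekt_lambda p * p 0 1; - (tau * Ekt_lambda p * p 0 0); 1]`_i.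

(* [pid_mx 2] is diag(1, 1, 0). *)
Definition Ekt_metric p : 'M[R]_3 :=
  Ekt_lambda p ^+ 2 *: pid_mx 2 + (Ekt_eta p)^T *m Ekt_eta p.

Definition Ekt_xi : 'rV[R]_3 := delta_mx 0 2.

Definition horizontal_geodesic (Gamma : set 'rV[R]_3) : Prop :=
  exists c : R -> 'rV[R]_3,
    [/\ geodesic Ekt Ekt_metric c,
        forall t, inner Ekt_metric (c t) (derive1 c t) Ekt_xi = 0 &
        Gamma = range c].

End Ekt.

(* The properties that characterise E(kappa, tau): xi is a unit field whose
   flow, complete, is by isometries; (x, y, z) |-> (x, y) is a Riemannian
   submersion onto the base with metric lambda^2 (dx^2 + dy^2); and
   nabla_v xi = tau v x xi, where the cross product is the one of the
   orientation dx /\ dy /\ dz, that is <v x xi, w> = Ekt_volume (v, xi, w). *)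
Section EktFacts.
Variables (R : realType) (kappa tau : R).
Implicit Types p v w : 'rV[R]_3.

Let g := Ekt_metric kappa tau.
Let lambda := Ekt_lambda kappa.

Definition Ekt_volume p u v w : R :=
  Num.sqrt (\det (g p)) * \det (\matrix_i [:: u; v; w]`_i).

Let etav p v : R := (v *m (Ekt_eta kappa tau p)^T) 0 0.

Let etavE p v : etav p v = tau * lambda p * (p 0 1 * v 0 0 - p 0 0 * v 0 1) + v 0 2.
Proof.
rewrite /etav !mxE !big_ord_recl big_ord0 !mxE /=.
have -> : lift ord0 ord0 = 1 :> 'I_3 by apply/val_inj.
have -> : lift ord0 (lift ord0 ord0) = 2 :> 'I_3 by apply/val_inj.
rewrite /lambda; have -> : ord0 = 0 :> 'I_3 by apply/val_inj.
ring.
Qed.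

Lemma Ekt_innerE p v w : inner g p v w =
  lambda p ^+ 2 * (v 0 0 * w 0 0 + v 0 1 * w 0 1) + etav p v * etav p w.
Proof.
rewrite /inner /g /Ekt_metric mulmxDr mulmxDl mxE; congr (_ + _).
  rewrite -scalemxAr -scalemxAl mxE; congr (_ * _).
  rewrite !mxE !big_ord_recl big_ord0 !mxE !big_ord_recl !big_ord0 !mxE /=.
  have -> : lift ord0 ord0 = 1 :> 'I_3 by apply/val_inj.
  have -> : lift ord0 (lift ord0 ord0) = 2 :> 'I_3 by apply/val_inj.
  have -> : ord0 = 0 :> 'I_3 by apply/val_inj.
  ring.
rewrite mulmxA -mulmxA.
rewrite mxE big_ord1; congr (_ * _).
by rewrite /etav -[Ekt_eta _ _ _ *m _]trmxK trmx_mul trmxK mxE.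
Qed.

Lemma Ekt_metric_sym p : (g p)^T = g p.
Proof.
rewrite /g /Ekt_metric linearD /= linearZ /= trmx_mul trmxK; congr (_ *: _ + _).
by rewrite tr_pid_mx.
Qed.

Lemma rV3P v w : v 0 0 = w 0 0 -> v 0 1 = w 0 1 -> v 0 2 = w 0 2 -> v = w.
Proof.
move=> h0 h1 h2; apply/rowP => -[[|[|[|//]]] hi].
- by rewrite (_ : Ordinal hi = 0) //; apply/val_inj.
- by rewrite (_ : Ordinal hi = 1) //; apply/val_inj.
- by rewrite (_ : Ordinal hi = 2) //; apply/val_inj.
Qed.

Lemma Ekt_metric_posdef p v : Ekt kappa p -> v != 0 -> 0 < inner g p v v.
Proof.
move=> Ep; apply: contraNT; rewrite -leNgt Ekt_innerE.
have l0 : 0 < lambda p by rewrite /lambda invr_gt0.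
move=> h; apply/eqP.
have h1 : lambda p ^+ 2 * (v 0 0 ^+ 2 + v 0 1 ^+ 2) = 0 /\ etav p v ^+ 2 = 0.
  have a1 : 0 <= lambda p ^+ 2 * (v 0 0 ^+ 2 + v 0 1 ^+ 2).
    by apply: mulr_ge0; rewrite ?addr_ge0 ?sqr_ge0.
  have a2 := sqr_ge0 (etav p v).
  by split; nra.
case: h1 => /eqP; rewrite mulf_eq0 expf_eq0 /= gt_eqF //= => h1 /eqP.
rewrite expf_eq0 /= etavE => /eqP h2.
move: h1; rewrite paddr_eq0 ?sqr_ge0 // !expf_eq0 /= => /andP[/eqP v0 /eqP v1].
by apply: rV3P; rewrite ?mxE //; move: h2; rewrite v0 v1 !mulr0 subrr mulr0 add0r.
Qed.

Lemma etav_xi p : etav p (Ekt_xi R) = 1.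
Proof. by rewrite etavE !mxE /= !mulr0 subrr mulr0 add0r. Qed.

Lemma Ekt_xi_unit p : inner g p (Ekt_xi R) (Ekt_xi R) = 1.
Proof. by rewrite Ekt_innerE etav_xi !mxE /=; ring. Qed.

Lemma Ekt_translation p t :
  (Ekt kappa (p + t *: Ekt_xi R) <-> Ekt kappa p) /\ g (p + t *: Ekt_xi R) = g p.
Proof.
have e (i : 'I_3) : (i < 2)%N -> (p + t *: Ekt_xi R) 0 i = p 0 i.
  by case: i => -[|[|//]] hi _; rewrite !mxE /= mulr0 addr0.
have hd : Ekt_denom kappa (p + t *: Ekt_xi R) = Ekt_denom kappa p.
  by rewrite /Ekt_denom !e.
split; first by rewrite /Ekt /= hd.
by rewrite /g /Ekt_metric /Ekt_eta /Ekt_lambda hd !e.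
Qed.

Lemma Ekt_submersion p v : inner g p v (Ekt_xi R) = 0 ->
  inner g p v v = lambda p ^+ 2 * (v 0 0 ^+ 2 + v 0 1 ^+ 2).
Proof.
by rewrite !Ekt_innerE etav_xi !mxE /= !mulr0 addr0 mulr0 add0r mulr1 => ->; ring.
Qed.


Lemma is_derive_ext (f h : 'rV[R]_3 -> R) p v (df dh : R) :
  is_derive p v f df -> f =1 h -> df = dh -> is_derive p v h dh.
Proof. by move=> hf /funext <- <-. Qed.

Lemma is_derive_inv (f : 'rV[R]_3 -> R) p v (df : R) : f p != 0 ->
  is_derive p v f df -> is_derive p v (fun q => (f q)^-1) (- (f p) ^- 2 * df).
Proof.
move=> f0 [h <-]; apply: DeriveDef; first exact: derivableV.
by rewrite deriveV.
Qed.

Lemma is_derive_coord (p v : 'rV[R]_3) (j : 'I_3) :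
  is_derive p v (fun q : 'rV[R]_3 => q 0 j : R) (v 0 j).
Proof.
have hd : differentiable (fun q : 'rV[R]_3 => q 0 j : R) p.
  exact: differentiable_coord.
apply: DeriveDef; first exact: diff_derivable.
rewrite deriveE //.
have @f : {linear 'rV[R]_3 -> R}.
  by exists (fun N : 'rV[R]_3 => N 0 j); do 2![eexists]; do ?[constructor];
     rewrite ?mxE// => ? *; rewrite ?mxE//; move=> ?; rewrite !mxE.
have -> : (fun q : 'rV[R]_3 => q 0 j : R) = f by [].
by rewrite diff_lin //; exact: coord_continuous.
Qed.

Lemma is_derive_lambda p v : Ekt kappa p ->
  is_derive p v (lambda : _ -> R)
    (- lambda p ^+ 2 * (kappa / 2 * (p 0 0 * v 0 0 + p 0 1 * v 0 1))).
Proof.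
move=> Ep; have d0 : Ekt_denom kappa p != 0 by rewrite gt_eqF.
have hd : is_derive p v (Ekt_denom kappa : _ -> R)
    (kappa / 2 * (p 0 0 * v 0 0 + p 0 1 * v 0 1)).
  have h0 := is_derive_coord p v 0; have h1 := is_derive_coord p v 1.
  apply: (is_derive_ext (is_deriveD (is_derive_cst (1 : R) p v)
    (is_deriveZ (kappa / 4) (is_deriveD (is_deriveM h0 h0) (is_deriveM h1 h1))))).
    by move=> q; rewrite /Ekt_denom !fctE !expr2.
  by rewrite /GRing.scale /=; field.
apply: (is_derive_ext (is_derive_inv d0 hd)) => //.
by rewrite /lambda /Ekt_lambda exprVn.
Qed.

Lemma is_derive_eta p v j : Ekt kappa p ->
  is_derive p v (fun q => Ekt_eta kappa tau q 0 j : R)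
  [:: tau * (lambda p * v 0 1 - lambda p ^+ 2 * (kappa / 2 * (p 0 0 * v 0 0 + p 0 1 * v 0 1)) * p 0 1);
      - tau * (lambda p * v 0 0 - lambda p ^+ 2 * (kappa / 2 * (p 0 0 * v 0 0 + p 0 1 * v 0 1)) * p 0 0) ; 0]`_j.
Proof.
move=> Ep; have hl := is_derive_lambda v Ep.
have h0 := is_derive_coord p v 0; have h1 := is_derive_coord p v 1.
case: j => -[|[|[|//]]] hi /=.
- apply: (is_derive_ext (is_deriveZ tau (is_deriveM hl h1))).
    by move=> q; rewrite mxE /= !fctE /GRing.scale /= mulrA.
  by rewrite /GRing.scale /=; ring.
- apply: (is_derive_ext (is_deriveZ (- tau) (is_deriveM hl h0))).
    by move=> q; rewrite mxE /= !fctE /GRing.scale /= mulrA !mulNr.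
  by rewrite /GRing.scale /=; ring.
- by apply: (is_derive_ext (is_derive_cst (1 : R) p v)) => // q; rewrite mxE.
Qed.

Lemma det3 (M : 'M[R]_3) : \det M =
  M 0 0 * (M 1 1 * M 2 2 - M 1 2 * M 2 1)
  - M 0 1 * (M 1 0 * M 2 2 - M 1 2 * M 2 0)
  + M 0 2 * (M 1 0 * M 2 1 - M 1 1 * M 2 0).
Proof.
pose m (i j : nat) := M (inord i) (inord j).
have E i j : M i j = m i j by rewrite /m !inord_val.
rewrite (expand_det_row _ 0) !big_ord_recl big_ord0 /cofactor.
rewrite !(expand_det_row _ ord0) !big_ord_recl !big_ord0 /cofactor !det_mx11.
by rewrite !mxE !E /= /bump /=; ring.
Qed.

Lemma sum3 (F : 'I_3 -> R) : \sum_i F i = F 0 + F 1 + F 2.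
Proof.
rewrite !big_ord_recl big_ord0 addr0 addrA.
by congr (F _ + F _ + F _); apply/val_inj.
Qed.

Lemma Ekt_metric_unit p : Ekt kappa p -> g p \in unitmx.
Proof.
move=> Ep; rewrite -row_free_unit -kermx_eq0; apply: contraT => /rowV0Pn[v].
move=> /sub_kermxP hv v0; have := Ekt_metric_posdef Ep v0.
by rewrite /inner hv mul0mx mxE ltxx.
Qed.

Lemma Ekt_det p : \det (g p) = lambda p ^+ 4.
Proof.
rewrite det3 /g /Ekt_metric !mxE !big_ord1 !mxE /=.
by rewrite /lambda; ring.
Qed.

Lemma Ekt_g2 p j : g p 2 j = Ekt_eta kappa tau p 0 j.
Proof.
by rewrite /g /Ekt_metric !mxE !big_ord1 !mxE /= andbF mulr0 add0r mul1r.
Qed.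

Lemma Ekt_bundle_curvature p v w : Ekt kappa p ->
  inner g p (connection g p v (Ekt_xi R)) w = tau * Ekt_volume p v (Ekt_xi R) w.
Proof.
move=> Ep.
pose F := \matrix_(i < 3, l < 3) (partial i (fun q => Ekt_eta kappa tau q 0 l) p
   - partial l (fun q => Ekt_eta kappa tau q 0 i) p).
have dg2 i l : partial 2 (fun q => g q i l) p = 0.
  rewrite /partial /derive (_ : (fun h => _) = cst 0).
    by apply: lim_cst; exact: Rhausdorff.
  apply/funext => h; rewrite /= /shift /= [_ + p]addrC.
  by rewrite (Ekt_translation p h).2 subrr scaler0.
have hC i k : christoffel g i 2 k p = (2^-1 *: (F *m (invmx (g p))^T)) i k.
  rewrite /christoffel !mxE; congr (_ * _); apply: eq_bigr => l _.
  have e1 : (fun q => g q 2 l) = (fun q => Ekt_eta kappa tau q 0 l).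
    by apply/funext => q; rewrite Ekt_g2.
  have e2 : (fun q => g q i 2) = (fun q => Ekt_eta kappa tau q 0 i).
    by apply/funext => q; rewrite -Ekt_g2 -[in LHS](Ekt_metric_sym q) mxE.
  rewrite !mxE mulrC dg2 addr0.
  rewrite -/g e1 e2 //.
have -> : connection g p v (Ekt_xi R) = 2^-1 *: (v *m F *m (invmx (g p))^T).
  apply/rowP => k; rewrite mxE -mulmxA scalemxAr mxE; apply: eq_bigr => i _.
  rewrite sum3 !mxE /= !mulr0 !add0r mulr1 hC mulrC.
  by rewrite !mxE.
rewrite /inner -!scalemxAl -!mulmxA trmx_inv Ekt_metric_sym.
rewrite (mulmxA (invmx _)) mulVmx ?Ekt_metric_unit // mul1mx.
rewrite /Ekt_volume Ekt_det det3.
have -> : Num.sqrt (lambda p ^+ 4) = lambda p ^+ 2.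
  by rewrite (exprM _ 2 2) sqrtr_sqr ger0_norm // sqr_ge0.
pose e (i l : 'I_3) : R := [:: tau * (lambda p * (delta_mx 0 i : 'rV[R]_3) 0 1 - lambda p ^+ 2 *
      (kappa / 2 * (p 0 0 * (delta_mx 0 i : 'rV[R]_3) 0 0 + p 0 1 * (delta_mx 0 i : 'rV[R]_3) 0 1)) * p 0 1);
    - tau * (lambda p * (delta_mx 0 i : 'rV[R]_3) 0 0 - lambda p ^+ 2 *
      (kappa / 2 * (p 0 0 * (delta_mx 0 i : 'rV[R]_3) 0 0 + p 0 1 * (delta_mx 0 i : 'rV[R]_3) 0 1)) * p 0 0); 0]`_l.
have he i (l : 'I_3) : partial i (fun q => Ekt_eta kappa tau q 0 l) p = e i l.
  by case: (is_derive_eta (delta_mx 0 i) l Ep).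
have -> : F = \matrix_(i < 3, l < 3) (e i l - e l i).
  by apply/matrixP => i l; rewrite !mxE !he.
have hl : lambda p * Ekt_denom kappa p = 1.
  by rewrite mulVf // gt_eqF.
rewrite !mxE !sum3 !mxE !sum3 !mxE /e !mxE /=.
move: hl; rewrite /Ekt_denom; move: (lambda p) => L hl.
transitivity (tau * (L - L * (L * (1 + kappa / 4 * (p 0 0 ^+ 2 + p 0 1 ^+ 2)))
                     + L ^+ 2) *
   (v 0 1 * w 0 0 - v 0 0 * w 0 1)).
  by field.
by rewrite hl; ring.
Qed.
End EktFacts.

Section Surfaces.
Variable R : realType.

Record chart (S : topologicalType) := Chart {
  chart_dom : set S;
  chart_map : S -> 'rV[R]_2;
  chart_inv : 'rV[R]_2 -> S }.

Definition chart_cod (S : topologicalType) (c : chart S) : set 'rV[R]_2 :=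
  chart_map c @` chart_dom c.

Definition is_chart (S : topologicalType) (c : chart S) : Prop :=
  [/\ open (chart_dom c),
      open (chart_cod c),
      forall x, chart_dom c x -> chart_inv c (chart_map c x) = x,
      forall x, chart_dom c x -> {for x, continuous (chart_map c)} &
      forall u, chart_cod c u -> {for u, continuous (chart_inv c)}].

Record smoothSurface := SmoothSurface {
  surface_space :> topologicalType;
  surface_atlas : set (chart surface_space);
  surface_nonempty : [set: surface_space] !=set0;
  surface_hausdorff : hausdorff_space surface_space;
  surface_second_countable : @second_countable surface_space;
  surface_charts : forall c, surface_atlas c -> is_chart c;
  surface_cover : forall x, exists2 c, surface_atlas c & chart_dom c x;
  surface_transition : forall c d, surface_atlas c -> surface_atlas d ->
    smooth_on (chart_map c @` (chart_dom c `&` chart_dom d))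
      (chart_map d \o chart_inv c) }.

Implicit Types (S : smoothSurface) (E : set 'rV[R]_3).
Implicit Types (g : 'rV[R]_3 -> 'M[R]_3) (X N : 'rV[R]_2 -> 'rV[R]_3).

Definition tangent_frame X (u : 'rV[R]_2) : 'M[R]_(2, 3) :=
  \matrix_(i < 2) partial i X u.

Definition immersion E S (phi : S -> 'rV[R]_3) : Prop :=
  (forall x, E (phi x)) /\
  forall c, surface_atlas c ->
    smooth_on (chart_cod c) (phi \o chart_inv c) /\
    forall u, chart_cod c u -> row_free (tangent_frame (phi \o chart_inv c) u).

Definition unit_normal g (U : set 'rV[R]_2) X N : Prop :=
  smooth_on U N /\
  forall u, U u ->
    inner g (X u) (N u) (N u) = 1 /\
    forall i, inner g (X u) (N u) (partial i X u) = 0.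

(* [A] is the matrix of the shape operator v |-> - nabla_v N in the frame of
   coordinate vectors (i-th row: image of the i-th vector). *)
Definition shape_operator g X N (u : 'rV[R]_2) (A : 'M[R]_2) : Prop :=
  forall i, - (partial i N u + connection g (X u) (partial i X u) (N u))
            = \sum_j A i j *: partial j X u.

(* The sign of the mean curvature depends on the unit normal, which is chosen
   chart by chart.  For H != 0 these choices necessarily agree on overlaps and
   orient the surface; minimal surfaces (H = 0) need not be orientable. *)
Definition constant_mean_curvature g (H : R) S (phi : S -> 'rV[R]_3) : Prop :=
  forall c, surface_atlas c ->
    let X := phi \o chart_inv c in
    exists2 N, unit_normal g (chart_cod c) X N &
      forall u, chart_cod c u ->
        exists2 A, shape_operator g X N u A & \tr A / 2 = H.

Definition proper_into E S (phi : S -> 'rV[R]_3) : Prop :=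
  forall K, compact K -> K `<=` E -> compact (phi @^-1` K).

Definition at_bounded_distance E g (A : set 'rV[R]_3) S
    (phi : S -> 'rV[R]_3) : Prop :=
  exists C : R, forall x, (dist_to_set E g A (phi x) <= C%:E)%E.

Definition properly_immersed_H_surface (kappa tau H : R) S
    (phi : S -> 'rV[R]_3) : Prop :=
  [/\ immersion (Ekt kappa) phi,
      proper_into (Ekt kappa) phi &
      constant_mean_curvature (Ekt_metric kappa tau) H phi].

End Surfaces.

(* Main.v *)
Require Import Defs.
From HB Require Import structures.
From mathcomp Require Import all_boot all_order all_algebra.
From mathcomp Require Import all_classical all_reals all_analysis.
From mathcomp Require Import ring lra.
Import Order.TTheory GRing.Theory Num.Theory.
Import numFieldNormedType.Exports.
Local Open Scope classical_set_scope.
Local Open Scope ring_scope.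

Set Implicit Arguments.
Unset Strict Implicit.
Unset Printing Implicit Defensive.

(** Since [4 H^2 + kappa <= 0], [kappa] is nonpositive and [2 |H|] is at most
    [k = sqrt (- kappa)].  The idea is to trap the surface between the level
    sets of a function whose mean curvature is too large for an H-surface to
    touch them.

    Let [gamma] be the geodesic of the base below [Gamma], [s] the function on
    the base that vanishes on [gamma] and has Hessian [- kappa s g] and
    [|ds|^2 = 1 - kappa s^2] (so [s] is [sinh] of the signed distance to [gamma]
    when [kappa = -1]), and [h] the height over [Gamma], a vertical coordinate
    invariant under the translations along [Gamma]
    ([horizontal_geodesic_level], [exists_height]).  Both vanish on [Gamma], and
    [ln (1 + s^2 + h^2)] is Lipschitz, so [s] and [h] are bounded on a surface at
    bounded distance from [Gamma] ([dist_bound]).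

    The translation-invariant graphs [h + G(s) = const] have mean curvature
    [psi' / 2], where [psi = m G' / W], [m = 1 - kappa s^2] and [W] is the length
    of the gradient of [h + G(s)].  The constraint is [psi < sqrt m], whose slope
    tends to [k], so that [psi = mu s] is allowed on any given bounded interval
    of values of [s] for some [mu > k] ([exists_profile]).  This is where the
    hypothesis enters: the level sets of [h + G(s)] are more curved than [H],
    uniformly on the region that contains the surface.

    The uniform gap survives the perturbation
    [f = h + G(s) - eps ln (1 + P)], where [P] is a proper function of the base
    for which [ln (1 + P)] has bounded derivatives ([exists_barrier_profile]).
    On the region where [s] and [h] are bounded, the sets [f >= A] are compact
    ([barrier_sublevel]), so that [f] attains a maximum on a properly immersed
    surface.  There the surface is tangent to a level set of [f] and lies on one
    side of it, and the second variation contradicts the gap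
    ([barrier_no_max]).

    Every derivative is taken along a curve, so that only functions of one real
    variable are differentiated; the connection is needed only through its
    pairing with a vector ([inner_connection]). *)

(** * Derivatives and maxima of real functions *)

Section RealDerivatives.
Context {R : realType}.
Implicit Types (f g : R -> R) (t : R).

Lemma derD f g t a b : is_derive t 1 f a -> is_derive t 1 g b ->
  is_derive t 1 (fun s => f s + g s) (a + b).
Proof. by move=> hf hg; exact: is_deriveD. Qed.

Lemma derN f t a : is_derive t 1 f a -> is_derive t 1 (fun s => - f s) (- a).
Proof. by move=> hf; exact: is_deriveN. Qed.

Lemma derM f g t a b : is_derive t 1 f a -> is_derive t 1 g b ->
  is_derive t 1 (fun s => f s * g s) (a * g t + f t * b).
Proof.
move=> hf hg; apply: (is_derive_eq (is_deriveM hf hg)).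
by rewrite /GRing.scale /= addrC (mulrC (g t)).
Qed.

Lemma derX2 f t a : is_derive t 1 f a ->
  is_derive t 1 (fun s => f s ^+ 2) (2 * f t * a).
Proof. by move=> hf; apply: (is_derive_eq (derM hf hf)); ring. Qed.

Lemma derV f t a : f t != 0 -> is_derive t 1 f a ->
  is_derive t 1 (fun s => (f s)^-1) (- (f t) ^- 2 * a).
Proof. by move=> h hf; exact: is_deriveV. Qed.

Lemma derC t (c : R) : is_derive t 1 (fun=> c) 0.
Proof. exact: is_derive_cst. Qed.

Lemma der_comp f g t a b : is_derive (g t) 1 f a -> is_derive t 1 g b ->
  is_derive t 1 (fun s => f (g s)) (a * b).
Proof. by move=> hf hg; exact: is_derive1_comp. Qed.

Lemma der_continuous f t a : is_derive t 1 f a -> {for t, continuous f}.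
Proof.
by case=> hf _; apply: differentiable_continuous; exact/derivable1_diffP.
Qed.

Lemma der_eq f t a b : is_derive t 1 f a -> is_derive t 1 f b -> a = b.
Proof.
move=> ha hb.
by rewrite -(@derive_val _ _ _ _ _ _ _ ha) (@derive_val _ _ _ _ _ _ _ hb).
Qed.

Lemma der_cst0 f : (forall t, is_derive t 1 f 0) -> forall t, f t = f 0.
Proof. by move=> h t; exact: is_derive_0_is_cst. Qed.

(** If the second derivative were positive, the first one would be positive
    just to the right of [0], and the mean value theorem would give larger
    values there. *)
Lemma der_local_max f f1 (f2 : R) :
  (\forall t \near (0 : R), is_derive (t : R) (1 : R) f (f1 t)) ->
  is_derive (0 : R) (1 : R) f1 f2 -> (\forall t \near (0 : R), f t <= f 0) ->
  f1 0 = 0 /\ f2 <= 0.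
Proof.
move=> hf hf1 hmax.
have [e /= e0 he] : \forall t \near (0 : R),
    is_derive (t : R) (1 : R) f (f1 t) /\ f t <= f 0.
  by near=> t; split; near: t.
have {}he t : -e < t < e -> is_derive t 1 f (f1 t) /\ f t <= f 0.
  by move=> /andP[h1 h2]; apply: he; rewrite /= sub0r normrN ltr_norml h1.
have h10 : f1 0 = 0.
  have h0 : is_derive (0 : R) (1 : R) f 0.
    apply: (@derive1_at_max _ f (- e) e 0).
    - lra.
    - by move=> t; rewrite in_itv /= => /he[[]].
    - by rewrite in_itv /=; lra.
    - by move=> t; rewrite in_itv /= => /he[].
  by apply: der_eq h0; apply: (he 0 _).1; lra.
split=> //; rewrite leNgt; apply/negP => f2_gt0.
have [d /= d0 hd] : \forall h \near (0 : R)^',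
    0 < h^-1 *: ((f1 \o shift 0) (h *: (1 : R)) - f1 0).
  case: hf1 => hd e2; apply: cvgr_gt f2_gt0; rewrite -e2; exact: hd.
pose m := Num.min (d / 2) (e / 2).
have m0 : 0 < m by rewrite lt_min !divr_gt0.
have md : m < d by rewrite gt_min; apply/orP; left; lra.
have me : m < e by rewrite gt_min; apply/orP; right; lra.
have hI t : 0 <= t <= m -> is_derive t 1 f (f1 t).
  by move=> ht; apply: (he t _).1; lra.
have [t||c] := @MVT _ f f1 0 m m0.
- by rewrite in_itv /= => /andP[h1 h2]; apply: hI; rewrite !ltW.
- apply: continuous_in_subspaceT => t; rewrite inE /= in_itv /= => /hI.
  exact: der_continuous.
rewrite in_itv /= => /andP[c0 cm].
have : 0 < f1 c.
  have := hd c; rewrite /= sub0r normrN gtr0_norm // => /(_ (lt_trans cm md)).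
  rewrite gt_eqF // => /(_ isT).
  by rewrite /GRing.scale /= addr0 mulr1 h10 subr0 pmulr_rgt0 // invr_gt0.
have : f m <= f 0 by apply: (he m _).2; lra.
rewrite subr0; nra.
Unshelve. all: by end_near. Qed.

End RealDerivatives.

(** Differentiates an explicit expression, the derivatives of its atoms being
    hypotheses.  The rules are chosen on the syntax of the function:
    [is_derive] is a class, and letting instance resolution or higher-order
    unification choose them diverges on expressions of this size. *)
Ltac der :=
  match goal with
  | |- is_derive _ _ (fun _ => ?c) _ => exact: derC
  | |- is_derive _ _ (fun s => @?f s + @?g s) _ =>
    notypeclasses refine (@derD _ f g _ _ _ _ _); der
  | |- is_derive _ _ (fun s => - @?f s) _ => notypeclasses refine (@derN _ f _ _ _); der
  | |- is_derive _ _ (fun s => @?f s * @?g s) _ =>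
    notypeclasses refine (@derM _ f g _ _ _ _ _); der
  | |- is_derive _ _ (fun s => (@?f s) ^+ 2) _ =>
    notypeclasses refine (@derX2 _ f _ _ _); der
  | |- _ => eassumption
  end.

(** * The base: conformal factor, linear functions, radial potential *)

Section Base.
Context {R : realType} (kappa : R).
Implicit Types (x y a b c : R).

Definition in_base x y : Prop := 0 < 1 + kappa / 4 * (x ^+ 2 + y ^+ 2).

Definition conf x y : R := (1 + kappa / 4 * (x ^+ 2 + y ^+ 2))^-1.

(** The restrictions to the hyperboloid of the linear forms of Minkowski space
    when [kappa < 0], in the Poincare disc; the affine functions when [kappa =
    0].  Their Hessian is [- kappa] times the function times the metric. *)
Definition linear_fn a b c x y : R :=
  conf x y * (a * x + b * y + c * (1 - kappa / 4 * (x ^+ 2 + y ^+ 2))).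

(** The partial derivatives of [linear_fn], simplified: see [der_linear_fn]. *)
Definition linear_fn_x a b c x y : R :=
  conf x y * (a - kappa / 2 * x * (c + linear_fn a b c x y)).

Definition linear_fn_y a b c x y : R :=
  conf x y * (b - kappa / 2 * y * (c + linear_fn a b c x y)).

(** [(cosh (k rho) - 1) / k^2], with [rho] the distance to the origin and [k^2
    = - kappa]; it is [rho^2 / 2] when [kappa = 0].  Its Hessian is [1 - kappa
    P] times the metric. *)
Definition radial x y : R := conf x y * (x ^+ 2 + y ^+ 2) / 2.

Lemma conf_gt0 x y : in_base x y -> 0 < conf x y.
Proof. by move=> h; rewrite invr_gt0. Qed.

Lemma confE x y : in_base x y -> conf x y * (1 + kappa / 4 * (x ^+ 2 + y ^+ 2)) = 1.
Proof. by move=> h; rewrite mulVf // gt_eqF. Qed.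

(** Euler's relation for [linear_fn]; it is what brings the derivative of the
    gradient into the covariant form of [der_linear_fn_x]. *)
Lemma linear_fn_radial a b c x y : in_base x y ->
  x * linear_fn_x a b c x y + y * linear_fn_y a b c x y =
  2 * linear_fn a b c x y * conf x y - c - linear_fn a b c x y.
Proof.
move=> h; have d0 : 1 + kappa / 4 * (x ^+ 2 + y ^+ 2) != 0 by rewrite gt_eqF.
rewrite /linear_fn_x /linear_fn_y /linear_fn /conf; field.
by move: d0; apply: contraNneq => e; apply/eqP; lra.
Qed.

Lemma linear_fn_grad_norm a b c x y : in_base x y -> a ^+ 2 + b ^+ 2 + kappa * c ^+ 2 = 1 ->
  linear_fn_x a b c x y ^+ 2 + linear_fn_y a b c x y ^+ 2 =
  conf x y ^+ 2 * (1 - kappa * linear_fn a b c x y ^+ 2).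
Proof.
move=> h h1; have d0 : 1 + kappa / 4 * (x ^+ 2 + y ^+ 2) != 0 by rewrite gt_eqF.
rewrite -h1 /linear_fn_x /linear_fn_y /linear_fn /conf; field.
by move: d0; apply: contraNneq => e; apply/eqP; lra.
Qed.

Lemma radial_grad_norm x y : in_base x y ->
  conf x y ^+ 2 * (x ^+ 2 + y ^+ 2) = 2 * radial x y - kappa * radial x y ^+ 2.
Proof.
move=> h; have d0 : 1 + kappa / 4 * (x ^+ 2 + y ^+ 2) != 0 by rewrite gt_eqF.
rewrite /radial /conf; field.
by move: d0; apply: contraNneq => e; apply/eqP; lra.
Qed.

Section Curve.
Variables (x y : R -> R) (t x1 y1 : R).
Hypothesis hx : is_derive t 1 x x1.
Hypothesis hy : is_derive t 1 y y1.
Hypothesis hd : in_base (x t) (y t).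

Lemma der_conf : is_derive t 1 (fun s => conf (x s) (y s))
  (- (conf (x t) (y t) ^+ 2 * (kappa / 2 * (x t * x1 + y t * y1)))).
Proof.
notypeclasses refine (is_derive_eq _ _).
  by notypeclasses refine (derV _ _); [rewrite gt_eqF|der].
by rewrite /conf /= exprVn; move: (_ ^- 2) => u; by field.
Qed.

Let hl := der_conf.

Lemma der_linear_fn a b c : is_derive t 1 (fun s => linear_fn a b c (x s) (y s))
  (linear_fn_x a b c (x t) (y t) * x1 + linear_fn_y a b c (x t) (y t) * y1).
Proof.
notypeclasses refine (is_derive_eq _ _); first by rewrite /linear_fn; der.
rewrite /linear_fn_x /linear_fn_y /linear_fn; move: (conf _ _) => l; by field.
Qed.

(** The term in [conf ^+ 2] is the Hessian [- kappa s g]; the other three are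
    the Christoffel symbols of a conformal metric applied to the gradient. *)
Lemma der_linear_fn_x a b c :
  is_derive t 1 (fun s => linear_fn_x a b c (x s) (y s))
  (let s := linear_fn a b c (x t) (y t) in let l := conf (x t) (y t) in
   let sx := linear_fn_x a b c (x t) (y t) in let sy := linear_fn_y a b c (x t) (y t) in
   - kappa * s * l ^+ 2 * x1 - l * kappa / 2 *
    ((x t * x1 + y t * y1) * sx + (sx * x1 + sy * y1) * x t
     - (x t * sx + y t * sy) * x1)).
Proof.
have hs := der_linear_fn a b c.
notypeclasses refine (is_derive_eq _ _); first by rewrite /linear_fn_x; der.
cbv beta zeta; rewrite linear_fn_radial // /linear_fn_x /linear_fn_y.
move: (conf _ _) (linear_fn _ _ _ _ _) => l u; by field.
Qed.

Lemma der_linear_fn_y a b c :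
  is_derive t 1 (fun s => linear_fn_y a b c (x s) (y s))
  (let s := linear_fn a b c (x t) (y t) in let l := conf (x t) (y t) in
   let sx := linear_fn_x a b c (x t) (y t) in let sy := linear_fn_y a b c (x t) (y t) in
   - kappa * s * l ^+ 2 * y1 - l * kappa / 2 *
    ((x t * x1 + y t * y1) * sy + (sx * x1 + sy * y1) * y t
     - (x t * sx + y t * sy) * y1)).
Proof.
have hs := der_linear_fn a b c.
notypeclasses refine (is_derive_eq _ _); first by rewrite /linear_fn_y; der.
cbv beta zeta; rewrite linear_fn_radial // /linear_fn_x /linear_fn_y.
move: (conf _ _) (linear_fn _ _ _ _ _) => l u; by field.
Qed.

Lemma der_radial : is_derive t 1 (fun s => radial (x s) (y s))
  (conf (x t) (y t) ^+ 2 * (x t * x1 + y t * y1)).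
Proof.
notypeclasses refine (is_derive_eq _ _); first by rewrite /radial; der.
cbv beta; have := confE hd; move: (conf _ _) => l hl1.
transitivity (l * (l * (1 + kappa / 4 * (x t ^+ 2 +
  y t ^+ 2)) - l * kappa / 4 * (x t ^+ 2 + y t ^+ 2)) * (x t * x1 + y t * y1));
    last by field.
by rewrite hl1; field.
Qed.

End Curve.
End Base.

(** * Pointwise continuity and the angle at an ideal point *)

Section PointwiseContinuity.
Context {R : realType} {T : topologicalType}.
Implicit Types (X Y : T -> R) (p : T).

Lemma contD X Y p : {for p, continuous X} -> {for p, continuous Y} ->
  {for p, continuous (fun s => X s + Y s)}.
Proof. by move=> h1 h2; exact: cvgD. Qed.

Lemma contN X p : {for p, continuous X} -> {for p, continuous (fun s => - X s)}.
Proof. by move=> h1; exact: cvgN. Qed.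

Lemma contM X Y p : {for p, continuous X} -> {for p, continuous Y} ->
  {for p, continuous (fun s => X s * Y s)}.
Proof. by move=> h1 h2; exact: cvgM. Qed.

Lemma contX2 X p : {for p, continuous X} -> {for p, continuous (fun s => X s ^+ 2)}.
Proof. by move=> h1; exact: (contM h1 h1). Qed.

Lemma contV X p : X p != 0 -> {for p, continuous X} ->
  {for p, continuous (fun s => (X s)^-1)}.
Proof. by move=> h h1; exact: cvgV. Qed.

Lemma contC (k : R) p : {for p, continuous (fun=> k : R)}.
Proof. exact: cvg_cst. Qed.

Lemma cont_comp (f : R -> R) X p : {for X p, continuous f} ->
  {for p, continuous X} -> {for p, continuous (fun s => f (X s))}.
Proof. by move=> hf hX; exact: (continuous_comp hX hf). Qed.

End PointwiseContinuity.

(** Continuity of an explicit expression, directed by its syntax like [der]. *)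
Ltac cont :=
  match goal with
  | |- @prop_for _ _ (fun _ => @continuous_at _ _ _ (fun _ => ?c)) _ => exact: contC
  | |- @prop_for _ _ (fun _ => @continuous_at _ _ _ (fun s => @?f s + @?g s)) _ =>
    apply: (@contD _ _ f g); cont
  | |- @prop_for _ _ (fun _ => @continuous_at _ _ _ (fun s => - @?f s)) _ =>
    apply: (@contN _ _ f); cont
  | |- @prop_for _ _ (fun _ => @continuous_at _ _ _ (fun s => @?f s * @?g s)) _ =>
    apply: (@contM _ _ f g); cont
  | |- @prop_for _ _ (fun _ => @continuous_at _ _ _ (fun s => (@?f s) ^+ 2)) _ =>
    apply: (@contX2 _ _ f); cont
  | |- _ => assumption
  end.

(** For [kappa = - k^2], let [z0 = (2 / k) (e1, e2)] be a point of the
    boundary circle.  The angle of [1 - z / z0] is the multivalued angle of [z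
    - z0] normalised to vanish at the origin; its real part is positive in the
    disc, so that an arctangent gives it. *)
Section BoundaryAngle.
Context {R : realType} (k e1 e2 : R).
Hypothesis he : e1 ^+ 2 + e2 ^+ 2 = 1.
Implicit Types x y : R.

Let u x y := 1 - k / 2 * (x * e1 + y * e2).
Let v x y := - (k / 2 * (y * e1 - x * e2)).

Definition boundary_angle x y : R := atan (v x y / u x y).

(** The squared Euclidean distance to [z0], in units of the radius of the
    circle. *)
Definition boundary_dist x y : R :=
  1 - k * (e1 * x + e2 * y) + k ^+ 2 / 4 * (x ^+ 2 + y ^+ 2).

Let u_gt0 x y : in_base (- k ^+ 2) x y -> 0 < u x y.
Proof.
rewrite /in_base /u => h; set s := x * e1 + y * e2.
have hs : s ^+ 2 + (x * e2 - y * e1) ^+ 2 = x ^+ 2 + y ^+ 2.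
  by rewrite -[RHS]mulr1 -he /s; ring.
have hs2 := sqr_ge0 (x * e2 - y * e1); have := sqr_ge0 k => hk.
have h1 : (k / 2 * s) ^+ 2 < 1.
  have -> : (k / 2 * s) ^+ 2 = k ^+ 2 / 4 * s ^+ 2 by field.
  nra.
nra.
Qed.

Let uvE x y : u x y ^+ 2 + v x y ^+ 2 = boundary_dist x y.
Proof.
rewrite /u /v /boundary_dist.
have -> : k ^+ 2 / 4 * (x ^+ 2 + y ^+ 2) =
  k ^+ 2 / 4 * (x ^+ 2 + y ^+ 2) * (e1 ^+ 2 + e2 ^+ 2) by rewrite he mulr1.
by field.
Qed.

Lemma boundary_dist_gt0 x y : in_base (- k ^+ 2) x y -> 0 < boundary_dist x y.
Proof. by move=> h; rewrite -uvE; have := u_gt0 h; have := sqr_ge0 (v x y); nra. Qed.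

Lemma boundary_angle_bounded x y : `|boundary_angle x y| <= pi.
Proof.
have := atan_gtNpi2 (v x y / u x y); have := atan_ltpi2 (v x y / u x y).
by have := pi_gt0 R; rewrite ler_norml /boundary_angle; lra.
Qed.

Lemma cont_boundary_angle (T : topologicalType) (X Y : T -> R) p :
  in_base (- k ^+ 2) (X p) (Y p) -> {for p, continuous X} -> {for p, continuous Y} ->
  {for p, continuous (fun s => boundary_angle (X s) (Y s))}.
Proof.
move=> h hX hY; rewrite /boundary_angle.
apply: (cont_comp (f := atan)); first exact: continuous_atan.
apply: contM; first by rewrite /v; cont.
apply: contV; first by rewrite gt_eqF // u_gt0.
by rewrite /u; cont.
Qed.

Lemma der_boundary_angle (x y : R -> R) (t x1 y1 : R) :
  is_derive t 1 x x1 -> is_derive t 1 y y1 -> in_base (- k ^+ 2) (x t) (y t) ->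
  is_derive t 1 (fun s => boundary_angle (x s) (y s))
   (k / 2 * ((e2 - k * y t / 2) * x1 + (k * x t / 2 - e1) * y1)
    / boundary_dist (x t) (y t)).
Proof.
move=> hx hy h; have u0 := u_gt0 h; have R0 := boundary_dist_gt0 h.
notypeclasses refine (is_derive_eq _ _).
  rewrite /boundary_angle; notypeclasses refine (@der_comp _ atan _ _ _ _ _ _);
    first exact: is_derive1_atan.
  notypeclasses refine (derM _ _); first by rewrite /v; der.
  notypeclasses refine (derV _ _); first by rewrite gt_eqF.
  by rewrite /u; der.
have h1 : 1 + (v (x t) (y t) / u (x t) (y t)) ^+ 2 =
    boundary_dist (x t) (y t) / u (x t) (y t) ^+ 2.
  by rewrite -uvE; field; rewrite gt_eqF.
rewrite h1.
have h2 : k / 2 * ((e2 - k * y t / 2) * x1 + (k * x t / 2 - e1) * y1) =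
   u (x t) (y t) * (- (k / 2 * (y1 * e1 - x1 * e2)))
   - v (x t) (y t) * (- (k / 2 * (x1 * e1 + y1 * e2))).
  have -> : k * y t / 2 = k * y t / 2 * (e1 ^+ 2 + e2 ^+ 2) by rewrite he mulr1.
  have -> : k * x t / 2 = k * x t / 2 * (e1 ^+ 2 + e2 ^+ 2) by rewrite he mulr1.
  by rewrite /u /v; field.
rewrite h2; move: u0 R0; rewrite [u (x t) (y t)]lock [v (x t) (y t)]lock.
move: (locked _) (locked _) (boundary_dist _ _) => u' v' r u0 R0.
by field; rewrite !gt_eqF.
Qed.

End BoundaryAngle.

(** * The height over a horizontal geodesic *)

Section Height.
Context {R : realType} (kappa tau a b c : R).
Hypothesis hk : kappa <= 0.
Hypothesis hn : a ^+ 2 + b ^+ 2 + kappa * c ^+ 2 = 1.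
Implicit Types x y : R.

Local Notation disc := (in_base kappa).
Local Notation lam := (conf kappa).
Local Notation sig := (linear_fn kappa a b c).
Local Notation sigx := (linear_fn_x kappa a b c).
Local Notation sigy := (linear_fn_y kappa a b c).

(** The horizontal gradient of the height is [twist] times the gradient of
    [linear_fn] turned by a right angle; that [height_form] is closed is the
    fact that the bundle curvature is the constant [tau]. *)
Definition twist x y : R := 2 * tau * sig x y / (1 - kappa * sig x y ^+ 2).

(** The differential of a height: it makes [dz + dw] agree, on horizontal
    vectors, with the form [twist * (- s_y dx + s_x dy)], which vanishes on [s
    = 0] and is invariant under the translations along this geodesic. *)
Definition height_form x y x1 y1 : R :=
  tau * lam x y * (y * x1 - x * y1)
  + twist x y * (sigx x y * y1 - sigy x y * x1).

(** [z + w] is invariant under the translations along a horizontal geodesic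
    above [linear_fn = 0].  The continuity and the bound are what compactness
    of the superlevel sets needs. *)
Record is_height (w : R -> R -> R) : Prop := IsHeight {
  height_der : forall (x y : R -> R) (t x1 y1 : R),
    is_derive t 1 x x1 -> is_derive t 1 y y1 -> disc (x t) (y t) ->
    is_derive t 1 (fun s => w (x s) (y s)) (height_form (x t) (y t) x1 y1);
  height_cont : forall (T : topologicalType) (X Y : T -> R) p,
    disc (X p) (Y p) -> {for p, continuous X} -> {for p, continuous Y} ->
    {for p, continuous (fun s => w (X s) (Y s))};
  height_bounded : forall r, exists M : R, forall x y, disc x y ->
    x ^+ 2 + y ^+ 2 <= r -> `|w x y| <= M }.

Lemma twist_denom_gt0 x y : 0 < 1 - kappa * sig x y ^+ 2.
Proof. by rewrite subr_gt0 (le_lt_trans _ ltr01) // mulr_le0_ge0 // sqr_ge0. Qed.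

(** In Nil or in Euclidean space the height is a quadratic polynomial. *)
Lemma exists_height_flat : kappa = 0 -> exists w, is_height w.
Proof.
move=> k0; have hab : a ^+ 2 = 1 - b ^+ 2 by rewrite -hn k0; ring.
exists (fun x y => tau * ((a ^+ 2 - b ^+ 2) * (x * y) + a * b * (y ^+ 2 - x ^+ 2)
   + 2 * c * (a * y - b * x))).
split.
- move=> x y t x1 y1 hx hy h.
  notypeclasses refine (is_derive_eq _ _); first by der.
  rewrite /height_form /twist /linear_fn_x /linear_fn_y /linear_fn /conf k0 !mul0r subr0
    addr0 invr1 !mul1r.
  apply/eqP; rewrite -subr_eq0; apply/eqP.
  (* Both sides are equal modulo [a ^+ 2 + b ^+ 2 = 1]. *)
  transitivity (tau * (a ^+ 2 + b ^+ 2 - 1) * (x1 * y t - x t * y1)).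
    by field.
  by rewrite hab subrK subrr mulr0 mul0r.
- move=> T X Y p h hX hY; cont.
- move=> r; exists (`|tau| * (`|a ^+ 2 - b ^+ 2| * r + `|a * b| * r
   + `|2 * c| * (`|a| * (1 + r) + `|b| * (1 + r)))).
  move=> x y h hr; have hx := sqr_ge0 x; have hy := sqr_ge0 y.
  have hxy1 := sqr_ge0 (x - y); have hxy2 := sqr_ge0 (x + y).
  have hx1 := sqr_ge0 (x - 1); have hx2 := sqr_ge0 (x + 1).
  have hy1 := sqr_ge0 (y - 1); have hy2 := sqr_ge0 (y + 1).
  have b1 : `|x * y| <= r by rewrite ler_norml; apply/andP; split; nra.
  have b2 : `|y ^+ 2 - x ^+ 2| <= r by rewrite ler_norml; apply/andP; split; nra.
  have b3 : `|x| <= 1 + r by rewrite ler_norml; apply/andP; split; nra.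
  have b4 : `|y| <= 1 + r by rewrite ler_norml; apply/andP; split; nra.
  rewrite normrM ler_wpM2l //.
  apply: (le_trans (ler_normD _ _)); apply: lerD.
    apply: (le_trans (ler_normD _ _)).
    by rewrite lerD // normrM ler_wpM2l.
  rewrite normrM ler_wpM2l //; apply: (le_trans (ler_normB _ _)).
  by rewrite lerD // normrM ler_wpM2l.
Qed.

(** Up to constants, [1 - kappa s^2] is the squared conformal factor times the
    squared distances to the two ideal end points of the geodesic, which lie
    in the directions [(e1 1, e2 1)] and [(e1 (-1), e2 (-1))].  Its
    logarithmic differential, turned by a right angle, is a multiple of the
    form that [twist] defines, so that the height is the sum of the angles at
    these end points. *)
Section Hyperbolic.
Variable k : R.
Hypothesis hk0 : 0 < k.
Hypothesis hkk : kappa = - k ^+ 2.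

Let n2 : R := a ^+ 2 + b ^+ 2.
Let n2E : (k * c) ^+ 2 = n2 - 1.
Proof. by rewrite /n2 -hn hkk; ring. Qed.
Let n2_gt0 : 0 < n2.
Proof. by have := sqr_ge0 (k * c); rewrite n2E; lra. Qed.

Let e1 (s : R) := (- (k * c) * a - s * b) / n2.
Let e2 (s : R) := (- (k * c) * b + s * a) / n2.

Let e_unit s : s ^+ 2 = 1 -> e1 s ^+ 2 + e2 s ^+ 2 = 1.
Proof.
move=> hs; have : e1 s ^+ 2 + e2 s ^+ 2 = ((k * c) ^+ 2 + s ^+ 2) / n2.
  by rewrite /e1 /e2 /n2; field; rewrite gt_eqF.
by rewrite n2E hs subrK divff // gt_eqF.
Qed.

Let N x y := a * x + b * y + c * (1 - kappa / 4 * (x ^+ 2 + y ^+ 2)).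
Let D x y := 1 + kappa / 4 * (x ^+ 2 + y ^+ 2).
Let Rp x y := boundary_dist k (e1 1) (e2 1) x y.
Let Rm x y := boundary_dist k (e1 (-1)) (e2 (-1)) x y.

Let RpRm x y : n2 * (Rp x y * Rm x y) = D x y ^+ 2 + k ^+ 2 * N x y ^+ 2.
Proof.
apply/eqP; rewrite -subr_eq0; apply/eqP.
(* Both sides are equal modulo the relation [n2E]; the cofactor is the
   coefficient of [(k * c) ^+ 2] in their difference. *)
transitivity ((k ^+ 2 * (a * x + b * y) ^+ 2 / n2
  - (1 + k ^+ 2 / 4 * (x ^+ 2 + y ^+ 2)) ^+ 2) * ((k * c) ^+ 2 - (n2 - 1))).
  rewrite /Rp /Rm /boundary_dist /e1 /e2 /D /N hkk /n2; field.
  by rewrite gt_eqF.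
by rewrite n2E subrr mulr0.
Qed.

Let sum_y x y :
  n2 * ((e2 1 - k * y / 2) * Rm x y + (e2 (-1) - k * y / 2) * Rp x y) =
  k * (y * D x y - 2 * N x y * b - k ^+ 2 * y * N x y * c).
Proof.
apply/eqP; rewrite -subr_eq0; apply/eqP.
(* The cofactor of [n2E] is again the coefficient of [(k * c) ^+ 2]. *)
transitivity ((- 2 * k * b * (a * x + b * y) / n2
  + k * y * (1 + k ^+ 2 / 4 * (x ^+ 2 + y ^+ 2))) * ((k * c) ^+ 2 - (n2 - 1))).
  rewrite /Rp /Rm /boundary_dist /e1 /e2 /D /N hkk /n2; field.
  by rewrite gt_eqF.
by rewrite n2E subrr mulr0.
Qed.

Let sum_x x y :
  n2 * ((k * x / 2 - e1 1) * Rm x y + (k * x / 2 - e1 (-1)) * Rp x y) =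
  - (k * (x * D x y - 2 * N x y * a - k ^+ 2 * x * N x y * c)).
Proof.
apply/eqP; rewrite -subr_eq0; apply/eqP.
transitivity (- (- 2 * k * a * (a * x + b * y) / n2
  + k * x * (1 + k ^+ 2 / 4 * (x ^+ 2 + y ^+ 2))) * ((k * c) ^+ 2 - (n2 - 1))).
  rewrite /Rp /Rm /boundary_dist /e1 /e2 /D /N hkk /n2; field.
  by rewrite gt_eqF.
by rewrite n2E subrr mulr0.
Qed.

Lemma exists_height_hyperbolic : exists w, is_height w.
Proof.
have u1 : e1 1 ^+ 2 + e2 1 ^+ 2 = 1 by apply: e_unit; rewrite expr1n.
have u2 : e1 (-1) ^+ 2 + e2 (-1) ^+ 2 = 1 by apply: e_unit; rewrite sqrrN expr1n.
exists (fun x y => 2 * tau / k ^+ 2 * (boundary_angle k (e1 1) (e2 1) x y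
                     + boundary_angle k (e1 (-1)) (e2 (-1)) x y)).
split.
- move=> x y t x1 y1 hx hy h.
  have h' : in_base (- k ^+ 2) (x t) (y t) by rewrite -hkk.
  have d1 := der_boundary_angle u1 hx hy h'.
  have d2 := der_boundary_angle u2 hx hy h'.
  notypeclasses refine (is_derive_eq _ _); first by der.
  have r1 : 0 < Rp (x t) (y t) := boundary_dist_gt0 u1 h'.
  have r2 : 0 < Rm (x t) (y t) := boundary_dist_gt0 u2 h'.
  move: (RpRm (x t) (y t)) (sum_x (x t) (y t)) (sum_y (x t) (y t)).
  rewrite -/(Rp (x t) (y t)) -/(Rm (x t) (y t)).
  move: r1 r2; move: (Rp _ _) (Rm _ _) => rp rm r1 r2 hR hX hY.
  rewrite mul0r add0r.
  transitivity (tau / k * ((n2 * ((e2 1 - k * y t / 2) * rm +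
    (e2 (-1) - k * y t / 2) * rp)) * x1
     + (n2 * ((k * x t / 2 - e1 1) * rm + (k * x t / 2 - e1 (-1)) * rp)) * y1)
      / (n2 * (rp * rm))).
    by field; rewrite (gt_eqF r1) (gt_eqF r2) (gt_eqF n2_gt0) (gt_eqF hk0).
  rewrite hX hY hR /height_form /twist /linear_fn_x /linear_fn_y /linear_fn /conf.
  have d0 : 0 < D (x t) (y t) by [].
  have q0 : 0 < D (x t) (y t) ^+ 2 + k ^+ 2 * N (x t) (y t) ^+ 2.
    by rewrite -hR !mulr_gt0.
  rewrite -/(N (x t) (y t)) -/(D (x t) (y t)) hkk.
  have -> : 1 - (- k ^+ 2) * ((D (x t) (y t))^-1 * N (x t) (y t)) ^+ 2 =
     (D (x t) (y t) ^+ 2 + k ^+ 2 * N (x t) (y t) ^+ 2) / D (x t) (y t) ^+ 2.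
    by field; rewrite gt_eqF.
  move: d0 q0; move: (D _ _) (N _ _) => d n d0 q0.
  by field; rewrite exprMn (gt_eqF d0) (gt_eqF q0) (gt_eqF hk0).
- move=> T X Y p h hX hY.
  have h' : in_base (- k ^+ 2) (X p) (Y p) by rewrite -hkk.
  have c1 := cont_boundary_angle u1 h' hX hY.
  have c2 := cont_boundary_angle u2 h' hX hY.
  by cont.
- move=> r; exists (`|2 * tau / k ^+ 2| * (pi + pi)) => x y _ _.
  rewrite normrM ler_wpM2l // (le_trans (ler_normD _ _)) //.
  by rewrite lerD // boundary_angle_bounded.
Qed.

End Hyperbolic.

Lemma exists_height : exists w, is_height w.
Proof.
case: (ltgtP kappa 0) hk => // [k0 _|k0 _]; last exact: exists_height_flat.
apply: (@exists_height_hyperbolic (Num.sqrt (- kappa))); first by rewrite sqrtr_gt0; lra.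
by rewrite sqr_sqrtr ?opprK //; lra.
Qed.

End Height.

(** * Graphs of prescribed mean curvature over the base *)

Section Profile.
Context {R : realType} (kappa tau : R).
Hypothesis hk : kappa <= 0.

(** For a function whose gradient has length [W], horizontal components [A]
    and [B] and vertical component [1], and with horizontal Hessian [h11, h12,
    h22], this is [W^3] times twice the mean curvature of the level set, that
    is [W^2] times the trace of the Hessian over the tangent plane: the mixed
    terms of the Hessian cancel by antisymmetry of the bundle curvature. *)
Definition graph_curvature (A B h11 h12 h22 : R) : R :=
  (1 + B ^+ 2) * h11 + (1 + A ^+ 2) * h22 - 2 * A * B * h12.

(** [A], [B] and the Hessian are those of [h + G(s)] in the orthonormal frame
    along and across the gradient of [s].  The last field says that its level
    sets have mean curvature [mu / 2]. *)
Record is_profile (C mu : R) (G g g1 : R -> R) : Prop := IsProfile {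
  profile_der : forall s : R, `|s| <= C -> is_derive s 1 G (g s);
  profile_der2 : forall s : R, `|s| <= C -> is_derive s 1 g (g1 s);
  profile_bounded : exists M : R, forall s : R, `|s| <= C ->
    [/\ `|G s| <= M, `|g s| <= M & `|g1 s| <= M];
  profile_curvature : forall s : R, `|s| <= C ->
    let m := 1 - kappa * s ^+ 2 in
    let A := Num.sqrt m * g s in
    let B := 2 * tau * s / Num.sqrt m in
    graph_curvature A B (m * g1 s - kappa * s * g s)
      (tau * (1 + kappa * s ^+ 2) / m) (- kappa * s * g s)
    = mu * Num.sqrt (1 + A ^+ 2 + B ^+ 2) ^+ 3 }.

Lemma antiderivative (f : R -> R) (C : R) :
  (forall s, `|s| <= C -> {for s, continuous f}) ->
  exists F : R -> R, forall s : R, `|s| < C -> is_derive s 1 F (f s).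
Proof.
move=> hf; exists (fun x => \int[lebesgue_measure]_(t in [set` `[- C, x]]) f t)%R.
move=> s hs; have := hs; rewrite ltr_norml => /andP[h1 h2].
have fi : lebesgue_measure.-integrable `[- C, C] (EFin \o f).
  apply: continuous_compact_integrable; first exact: segment_compact.
  apply: continuous_in_subspaceT => t; rewrite inE /= in_itv /= -ler_norml.
  exact: hf.
have [d1 d2] := continuous_FTC1_closed h2 fi h1 (hf s (ltW hs)).
by apply: DeriveDef; [exact: d1|rewrite -derive1E].
Qed.

Lemma bounded_on_segment (f : R -> R) (C : R) : 0 < C ->
  (forall s, `|s| <= C -> {for s, continuous f}) ->
  exists M : R, forall s, `|s| <= C -> `|f s| <= M.
Proof.
move=> C0 hf; have [||c _ hc] := @EVT_max _ (fun s => `|f s|) (- C) C.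
- lra.
- apply: continuous_in_subspaceT => t; rewrite inE /= in_itv /= -ler_norml => /hf h.
  exact: (continuous_comp h (@norm_continuous _ _ _)).
exists `|f c| => s; rewrite ler_norml => hs; apply: hc.
by rewrite in_itv.
Qed.

(** The first integral [m G' / W = mu s], with [W] the length of the gradient,
    is solved for [W]: one finds [W^2 = n / e], where [n = m + 4 tau^2 s^2]
    and [e = m - mu^2 s^2 = 1 - a s^2] if [mu^2 = a - kappa].  So the profile
    exists as long as [a s^2 < 1], and [a > 0] can be as small as the interval
    requires. *)
Section Construction.
Variables (C a : R).
Hypothesis hC : 0 < C.
Hypothesis ha : 0 < a.
Hypothesis haC : a * C ^+ 2 <= 1 / 2.

Let mu : R := Num.sqrt (a - kappa).
Let m (s : R) : R := 1 + - (kappa * s ^+ 2).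
Let n (s : R) : R := m s + 4 * tau ^+ 2 * s ^+ 2.
Let e (s : R) : R := 1 + - (a * s ^+ 2).
Let r (s : R) : R := n s * (e s)^-1.
Let W (s : R) : R := Num.sqrt (r s).
Let g (s : R) : R := mu * s * (m s)^-1 * W s.
Let W1 (s : R) : R := s * (4 * tau ^+ 2 - kappa + a * r s) * (e s)^-1 * (W s)^-1.
Let g1 (s : R) : R := mu * (m s)^-1 * W s + 2 * kappa * mu * s ^+ 2 * (m s ^+ 2)^-1 * W s
  + mu * s * (m s)^-1 * W1 s.

Let mu2 : mu ^+ 2 = a - kappa.
Proof. by rewrite sqr_sqrtr // subr_ge0 (le_trans hk) // ltW. Qed.

Let m_ge1 s : 1 <= m s.
Proof. by rewrite /m lerDl oppr_ge0 mulr_le0_ge0 // sqr_ge0. Qed.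

Let m_gt0 s : 0 < m s := lt_le_trans ltr01 (m_ge1 s).

Let n_gt0 s : 0 < n s.
Proof. by rewrite /n ltr_pwDl // mulr_ge0 ?sqr_ge0 // mulr_ge0 // sqr_ge0. Qed.

Let e_gt0 s : `|s| <= C -> 0 < e s.
Proof.
move=> hs; have : s ^+ 2 <= C ^+ 2 by rewrite -real_normK ?num_real // ler_sqr ?nnegrE //
  ltW.
move=> /(ler_wpM2l (ltW ha)) h; have := haC; rewrite /e; lra.
Qed.

Let r_gt0 s : `|s| <= C -> 0 < r s.
Proof. by move=> hs; rewrite mulr_gt0 // invr_gt0 e_gt0. Qed.

Let W_gt0 s : `|s| <= C -> 0 < W s.
Proof. by move=> hs; rewrite sqrtr_gt0 r_gt0. Qed.

Let W2 s : `|s| <= C -> W s ^+ 2 = r s.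
Proof. by move=> hs; rewrite sqr_sqrtr // ltW // r_gt0. Qed.

Let der_id (s : R) : is_derive s 1 (fun u : R => u) 1.
Proof. exact: is_derive_id. Qed.

Let der_W (s : R) : `|s| <= C -> is_derive s 1 W (W1 s).
Proof.
move=> hs; have d0 := der_id s; have he := e_gt0 hs; have hr := r_gt0 hs.
have hW := W_gt0 hs.
notypeclasses refine (is_derive_eq _ _).
  notypeclasses refine (@der_comp _ Num.sqrt _ _ _ _ _ _).
    exact: is_derive1_sqrt.
  rewrite /r; notypeclasses refine (derM _ _); first by rewrite /n /m; der.
  notypeclasses refine (derV _ _); first by rewrite gt_eqF.
  by rewrite /e; der.
rewrite /W1 -/(W s) /r; move: he hW; move: (n s) (W s) => n' w; rewrite /e => he hw.
by field; rewrite !gt_eqF.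
Qed.

Let der_g (s : R) : `|s| <= C -> is_derive s 1 g (g1 s).
Proof.
move=> hs; have d0 := der_id s; have dW := der_W hs; have hm := m_gt0 s.
notypeclasses refine (is_derive_eq _ _).
  rewrite /g; notypeclasses refine (derM _ dW).
  notypeclasses refine (derM _ _); first exact: (derM (derC s mu) d0).
  notypeclasses refine (derV _ _); first by rewrite gt_eqF.
  by rewrite /m; der.
rewrite /g1; move: (W s) (W1 s) hm; rewrite /m => w w1 hm.
by field; rewrite gt_eqF.
Qed.

Let cont_id (s : R) : {for s, continuous (fun u : R => u)}.
Proof. exact: cvg_id. Qed.

Let cont_g1 (s : R) : `|s| <= C -> {for s, continuous g1}.
Proof.
move=> hs; have c0 := @cont_id s.
have cW : {for s, continuous W} by exact: der_continuous (der_W hs).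
have cm : {for s, continuous m} by rewrite /m; cont.
have cm' : {for s, continuous (fun u => (m u)^-1)} by apply: contV => //; rewrite gt_eqF.
have cm2 : {for s, continuous (fun u => (m u ^+ 2)^-1)}.
  by apply: contV; [rewrite gt_eqF // exprn_gt0|cont].
have ce : {for s, continuous (fun u => (e u)^-1)}.
  by apply: contV; [rewrite gt_eqF // e_gt0|rewrite /e; cont].
have cn : {for s, continuous n} by rewrite /n; cont.
have cW' : {for s, continuous (fun u => (W u)^-1)}.
  by apply: contV => //; rewrite gt_eqF // W_gt0.
by rewrite /g1 /W1 /r; cont.
Qed.

Let curvature_g s : `|s| <= C ->
    let m := 1 - kappa * s ^+ 2 in
    let A := Num.sqrt m * g s in
    let B := 2 * tau * s / Num.sqrt m in
    graph_curvature A B (m * g1 s - kappa * s * g s)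
      (tau * (1 + kappa * s ^+ 2) / m) (- kappa * s * g s)
    = mu * Num.sqrt (1 + A ^+ 2 + B ^+ 2) ^+ 3.
Proof.
move=> hs; cbv zeta; rewrite -/(m s).
have hm := m_gt0 s; have he := e_gt0 hs; have hn := n_gt0 s; have hW := W_gt0 hs.
have hrm : 0 < Num.sqrt (m s) by rewrite sqrtr_gt0.
set A := Num.sqrt (m s) * g s; set B := _ / Num.sqrt (m s).
have A2 : A ^+ 2 = m s * g s ^+ 2 by rewrite exprMn sqr_sqrtr // ltW.
have B2 : B ^+ 2 = (2 * tau * s) ^+ 2 / m s.
  by rewrite exprMn exprVn sqr_sqrtr // ltW.
have AB : A * B = 2 * tau * s * g s by rewrite /A /B; field; rewrite gt_eqF.
have g2 : g s ^+ 2 = (a - kappa) * s ^+ 2 * n s / (m s ^+ 2 * e s).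
  rewrite /g !exprMn W2 // mu2 /r; by field; rewrite !gt_eqF.
have -> : 1 + A ^+ 2 + B ^+ 2 = r s.
  rewrite A2 B2 g2 /r; have -> : n s = m s + 4 * tau ^+ 2 * s ^+ 2 by [].
  move: hm he; rewrite /m /e => hm he; by field; rewrite !gt_eqF.
rewrite -/(W s) /graph_curvature -(mulrA 2 A B) AB A2 B2 (exprSr (W s) 2) W2 // g2.
have W1E : W1 s = W s * (s * (4 * tau ^+ 2 - kappa + a * r s) / n s).
  rewrite /W1; have -> : (W s)^-1 = W s * e s / n s.
    by rewrite -[LHS](mulVKf (lt0r_neq0 hW)) -invfM -expr2 W2 // /r; field; rewrite !gt_eqF.
  by field; rewrite !gt_eqF.
rewrite /g /g1 W1E /r; move: (W s) => w.
move: hn hm he; rewrite /n /m /e => hn hm he; by field; rewrite !gt_eqF.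
Qed.

Lemma exists_profile_aux :
  exists G g0 g01, is_profile (C / 2) (Num.sqrt (a - kappa)) G g0 g01.
Proof.
have cg s (hs : `|s| <= C) := der_continuous (der_g hs).
have [G hG] := antiderivative cg.
have C0 := hC.
(* The antiderivative is differentiable in the open interval only. *)
have CC (s : R) : `|s| <= C / 2 -> `|s| < C by move=> hs; lra.
have CC' (s : R) : `|s| <= C / 2 -> `|s| <= C by move=> /CC /ltW.
have C20 : 0 < C / 2 by lra.
exists G, g, g1; split.
- by move=> s /CC; exact: hG.
- by move=> s /CC'; exact: der_g.
- have [M1 h1] := bounded_on_segment C20 (fun s hs => der_continuous (hG s (CC s hs))).
  have [M2 h2] := bounded_on_segment C20 (fun s hs => cg s (CC' s hs)).
  have [M3 h3] := bounded_on_segment C20 (fun s hs => cont_g1 (CC' s hs)).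
  exists (Num.max M1 (Num.max M2 M3)) => s hs.
  by split; rewrite !le_max ?h1 ?h2 ?h3 ?orbT.
- by move=> s /CC' hs; exact: curvature_g.
Qed.

End Construction.

(** Taking [a] small enough for the interval still leaves [mu^2 = a - kappa]
    above [k^2]. *)
Lemma exists_profile (C k : R) : 0 < C -> 0 <= k -> k ^+ 2 <= - kappa ->
  exists mu G g g1, k < mu /\ is_profile C mu G g g1.
Proof.
move=> C0 k0 hk2; pose a := (8 * C ^+ 2)^-1.
have C2 : 0 < C ^+ 2 by rewrite exprn_gt0.
have a0 : 0 < a by rewrite invr_gt0; lra.
have haC : a * (2 * C) ^+ 2 <= 1 / 2.
  by rewrite /a le_eqVlt; apply/orP; left; apply/eqP; field; rewrite gt_eqF.
have C20 : 0 < 2 * C by lra.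
have [G [g [g1 h]]] := exists_profile_aux C20 a0 haC.
exists (Num.sqrt (a - kappa)), G, g, g1; split.
  have h1 : k ^+ 2 < a - kappa by rewrite (le_lt_trans hk2) // ltrDr.
  by rewrite -[ltLHS]ger0_norm // -sqrtr_sqr ltr_sqrt // (le_lt_trans (sqr_ge0 k)).
by have <- : 2 * C / 2 = C by field.
Qed.

End Profile.

(** * Stability of the strict curvature inequality *)

(** Functions on a set of parameters, compared up to a multiple of the small
    parameter [eps].  This turns the perturbation argument into closure
    properties under sums, products and square roots. *)
Section Approximation.
Context {R : realType} {X : Type} (P : X -> Prop) (eps : X -> R).
Hypothesis heps : forall x, P x -> 0 <= eps x <= 1.
Implicit Types f g : X -> R.

Definition bounded_fn f := exists M : R, forall x, P x -> `|f x| <= M.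
Definition approx f g := exists K : R, forall x, P x -> `|f x - g x| <= K * eps x.

Lemma bounded_fnP f : bounded_fn f -> exists2 M : R, 0 <= M & forall x, P x -> `|f x| <= M.
Proof.
by case=> M h; exists `|M| => // x Px; rewrite (le_trans (h x Px)) // ler_norm.
Qed.

Lemma approxP f g : approx f g ->
  exists2 K : R, 0 <= K & forall x, P x -> `|f x - g x| <= K * eps x.
Proof.
case=> K h; exists `|K| => // x Px; have /andP[e0 _] := heps Px.
by rewrite (le_trans (h x Px)) // ler_wpM2r // ler_norm.
Qed.

Lemma bounded_fnC (c : R) : bounded_fn (fun=> c).
Proof. by exists `|c|. Qed.

Lemma bounded_fnD f g : bounded_fn f -> bounded_fn g -> bounded_fn (fun x => f x + g x).
Proof.
move=> [M h] [N h']; exists (M + N) => x Px.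
by rewrite (le_trans (ler_normD _ _)) // lerD // ?h ?h'.
Qed.

Lemma bounded_fnN f : bounded_fn f -> bounded_fn (fun x => - f x).
Proof. by move=> [M h]; exists M => x Px; rewrite normrN h. Qed.

Lemma bounded_fnM f g : bounded_fn f -> bounded_fn g -> bounded_fn (fun x => f x * g x).
Proof.
move=> /bounded_fnP[M M0 h] /bounded_fnP[N N0 h']; exists (M * N) => x Px.
by rewrite normrM ler_pM // ?h ?h'.
Qed.

Lemma approx_refl f : approx f f.
Proof. by exists 0 => x Px; rewrite subrr normr0 mul0r. Qed.

Lemma approx_eps f : bounded_fn f -> approx (fun x => eps x * f x) (fun=> 0).
Proof.
move=> [M h]; exists M => x Px; have /andP[e0 _] := heps Px.
by rewrite subr0 normrM ger0_norm // mulrC ler_wpM2r // h.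
Qed.

Lemma approx_bounded f g : approx f g -> bounded_fn g -> bounded_fn f.
Proof.
move=> /approxP[K K0 h] [M h']; exists (K + M) => x Px.
rewrite -[f x](subrK (g x)) (le_trans (ler_normD _ _)) // lerD ?h' //.
by rewrite (le_trans (h x Px)) // ler_piMr //; have /andP[] := heps Px.
Qed.

Lemma approxD f f' g g' : approx f f' -> approx g g' ->
  approx (fun x => f x + g x) (fun x => f' x + g' x).
Proof.
move=> [K h] [L h']; exists (K + L) => x Px.
by rewrite opprD addrACA mulrDl (le_trans (ler_normD _ _)) // lerD // ?h ?h'.
Qed.

Lemma approxN f f' : approx f f' -> approx (fun x => - f x) (fun x => - f' x).
Proof. by move=> [K h]; exists K => x Px; rewrite -opprD normrN h. Qed.

Lemma approxM f f' g g' : bounded_fn f' -> bounded_fn g' ->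
  approx f f' -> approx g g' -> approx (fun x => f x * g x) (fun x => f' x * g' x).
Proof.
move=> bf bg af ag; have /bounded_fnP[M M0 hM] := approx_bounded af bf.
move: bg => /bounded_fnP[N N0 hN].
move: af ag => /approxP[K K0 hK] /approxP[L L0 hL].
exists (M * L + K * N) => x Px; have /andP[e0 _] := heps Px.
have -> : f x * g x - f' x * g' x = f x * (g x - g' x) + (f x - f' x) * g' x by ring.
rewrite [leRHS]mulrDl (le_trans (ler_normD _ _)) // lerD // normrM.
  by rewrite -mulrA ler_pM // ?hM ?hL.
by rewrite mulrAC ler_pM // ?hK ?hN.
Qed.

Lemma approx_sqrt f f' : (forall x, 1 <= f x) -> (forall x, 1 <= f' x) ->
  approx f f' -> approx (fun x => Num.sqrt (f x)) (fun x => Num.sqrt (f' x)).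
Proof.
move=> h1 h2 [K hK]; exists K => x Px; apply: le_trans (hK x Px).
have s1 : 1 <= Num.sqrt (f x) by rewrite -[1]sqrtr1 ler_wsqrtr.
have s2 : 1 <= Num.sqrt (f' x) by rewrite -[1]sqrtr1 ler_wsqrtr.
rewrite -[in leRHS](sqr_sqrtr (le_trans ler01 (h1 x))).
rewrite -[in leRHS](sqr_sqrtr (le_trans ler01 (h2 x))).
rewrite subr_sqr normrM ler_peMr // ger0_norm; lra.
Qed.

Lemma bounded_sqrt f : (forall x, 1 <= f x) -> bounded_fn f ->
  bounded_fn (fun x => Num.sqrt (f x)).
Proof.
move=> h1 [M hM]; exists M => x Px; apply: le_trans (hM x Px).
have s1 : 1 <= Num.sqrt (f x) by rewrite -[1]sqrtr1 ler_wsqrtr.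
rewrite -[in leRHS](sqr_sqrtr (le_trans ler01 (h1 x))) expr2 normrM.
by rewrite ler_peMr // ger0_norm; lra.
Qed.

End Approximation.

Ltac bnd :=
  match goal with
  | |- bounded_fn _ (fun _ => ?c) => exact: bounded_fnC
  | |- bounded_fn _ (fun x => @?f x + @?g x) => apply: (@bounded_fnD _ _ _ f g); bnd
  | |- bounded_fn _ (fun x => - @?f x) => apply: (@bounded_fnN _ _ _ f); bnd
  | |- bounded_fn _ (fun x => @?f x * @?g x) => apply: (@bounded_fnM _ _ _ f g); bnd
  | |- _ => assumption
  end.

Section Perturbation.
Context {R : realType} (k mu M : R).

(** A point of the parameter space: the size of the perturbation, the
    derivatives of the unperturbed function, and those of the perturbation. *)
Record jet := Jet { jeps : R; jA : R; jB : R; j11 : R; j12 : R; j22 : R;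
  pA : R; pB : R; p11 : R; p12 : R; p22 : R }.

Let good (x : jet) : Prop := 0 <= jeps x <= 1 /\
  (([/\ `|jA x| <= M, `|jB x| <= M, `|j11 x| <= M, `|j12 x| <= M & `|j22 x| <= M]) /\
  [/\ `|pA x| <= M, `|pB x| <= M, `|p11 x| <= M, `|p12 x| <= M & `|p22 x| <= M]).

Let heps x : good x -> 0 <= jeps x <= 1.
Proof. by case. Qed.

(** Since [W >= 1], the gap between [mu W^3] and [k W^3] is at least [mu - k],
    whereas both sides of the inequality move by at most a multiple of [e]. *)
Lemma curvature_stable : 0 <= k < mu -> exists2 e : R, 0 < e &
  forall A B h11 h12 h22 a b c11 c12 c22 : R,
  [/\ `|A| <= M, `|B| <= M, `|h11| <= M, `|h12| <= M & `|h22| <= M] ->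
  [/\ `|a| <= M, `|b| <= M, `|c11| <= M, `|c12| <= M & `|c22| <= M] ->
  graph_curvature A B h11 h12 h22 = mu * Num.sqrt (1 + A ^+ 2 + B ^+ 2) ^+ 3 ->
  k * Num.sqrt (1 + (A + e * a) ^+ 2 + (B + e * b) ^+ 2) ^+ 3 <
  graph_curvature (A + e * a) (B + e * b) (h11 + e * c11) (h12 + e * c12) (h22 + e * c22).
Proof.
move=> /andP[k0 kmu].
have [bA bB b11 b12 b22] : [/\ bounded_fn good jA, bounded_fn good jB,
  bounded_fn good j11, bounded_fn good j12 & bounded_fn good j22].
  by split; exists M => x [_ [[? ? ? ? ?] _]].
have [qA qB q11 q12 q22] : [/\ bounded_fn good pA, bounded_fn good pB,
  bounded_fn good p11, bounded_fn good p12 & bounded_fn good p22].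
  by split; exists M => x [_ [_ [? ? ? ? ?]]].
have pert f p : bounded_fn good p ->
    approx good jeps (fun x => f x + jeps x * p x) f.
  move=> bp; have := approxD (approx_refl good jeps f) (approx_eps heps bp).
  by case=> K hK; exists K => x Px; have := hK x Px; rewrite addr0.
have aA := pert jA pA qA; have aB := pert jB pB qB.
have a11 := pert j11 p11 q11; have a12 := pert j12 p12 q12; have a22 := pert j22 p22 q22.
have bA2 : bounded_fn good (fun x => jA x * jA x) by bnd.
have bB2 : bounded_fn good (fun x => jB x * jB x) by bnd.
have aA2 := approxM heps bA bA aA aA; have aB2 := approxM heps bB bB aB aB.
have a1 (c : R) := approx_refl good jeps (fun=> c).
have c1 (c : R) := bounded_fnC good c.
have b1B := bounded_fnD (c1 1) bB2; have b1A := bounded_fnD (c1 1) bA2.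
have aQ := approxD (approxD (approxM heps b1B b11 (approxD (a1 1) aB2) a11)
   (approxM heps b1A b22 (approxD (a1 1) aA2) a22))
   (approxN (approxM heps (bounded_fnM (bounded_fnM (c1 2) bA) bB) b12
     (approxM heps (bounded_fnM (c1 2) bA) bB (approxM heps (c1 2) bA (a1 2) aA) aB) a12)).
have ge1 (u v : R) : 1 <= 1 + u * u + v * v.
  by rewrite -addrA lerDl addr_ge0 // -expr2 sqr_ge0.
have aW := approx_sqrt (fun x => ge1 (jA x + jeps x * pA x) (jB x + jeps x * pB x))
  (fun x => ge1 (jA x) (jB x)) (approxD (approxD (a1 1) aA2) aB2).
have bW := bounded_sqrt (fun x => ge1 (jA x) (jB x)) (bounded_fnD b1A bB2).
have aW3 := approxM heps bW (bounded_fnM bW bW) aW (approxM heps bW bW aW aW).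
have [K K0 hK] := approxP heps aQ; have [L L0 hL] := approxP heps aW3.
move: aQ aW3 => _ _.
pose e := Num.min 1 ((mu - k) / (2 * (K + k * L + 1))).
have d0 : 0 < 2 * (K + k * L + 1) by rewrite mulr_gt0 // ltr_wpDl // addr_ge0 // mulr_ge0.
have e0 : 0 < e by rewrite lt_min ltr01 divr_gt0 // subr_gt0.
have e1 : e <= 1 by rewrite ge_min lexx.
have e2 : e * (2 * (K + k * L + 1)) <= mu - k.
  by rewrite -ler_pdivlMr // ge_min lexx orbT.
exists e => // A B h11 h12 h22 a b c11 c12 c22 hj hp hQ.
pose x := Jet e A B h11 h12 h22 a b c11 c12 c22.
have gx : good x by split=> //=; rewrite e1 ltW.
have /= := hK x gx; have /= := hL x gx.
have W1 : 1 <= Num.sqrt (1 + A * A + B * B) by have := ler_wsqrtr (ge1 A B); rewrite sqrtr1.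
have X3 (u : R) : u ^+ 3 = u * (u * u) by rewrite !exprS expr0 mulr1.
move: hQ; rewrite /graph_curvature !X3 !expr2.
move: W1; set w := Num.sqrt (1 + A * A + B * B); set w' := Num.sqrt _.
move: w w' => w w' W1.
set q := (1 + (B + _) * _) * _ + _ - _; move: q => q ->.
rewrite !ler_norml => /andP[_ l2] /andP[l3 _].
have W3 : 1 <= w * (w * w) by rewrite mulr_ege1 // mulr_ege1.
have : k * (w' * (w' * w')) <= k * (w * (w * w) + L * e) by rewrite ler_wpM2l //; lra.
have : (mu - k) * 1 <= (mu - k) * (w * (w * w)) by rewrite ler_wpM2l //; lra.
move: e2 l3 e0; nra.
Qed.

End Perturbation.

Section BarrierProfile.
Context {R : realType} (kappa tau : R).
Hypothesis hk : kappa <= 0.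

(** [q1] and [q2] stand for the components of the gradient of [ln (1 + P)] and
    [th - q1 ^+ 2], [- (q1 * q2)], [th - q2 ^+ 2] for its Hessian, [P] being
    the radial potential; the relation between [q1], [q2] and [P] is
    [radial_grad_norm]. *)
Record is_barrier_profile (C H eps : R) (G g g1 : R -> R) : Prop := IsBarrierProfile {
  barrier_eps_gt0 : 0 < eps;
  barrier_der : forall s : R, `|s| <= C -> is_derive s 1 G (g s);
  barrier_der2 : forall s : R, `|s| <= C -> is_derive s 1 g (g1 s);
  barrier_bounded : exists M : R, forall s : R, `|s| <= C -> `|G s| <= M;
  barrier_curvature : forall s q1 q2 P : R, `|s| <= C -> 0 <= P ->
    (q1 ^+ 2 + q2 ^+ 2) * (1 + P) ^+ 2 = 2 * P - kappa * P ^+ 2 ->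
    let m := 1 - kappa * s ^+ 2 in
    let th := (1 - kappa * P) / (1 + P) in
    let A := Num.sqrt m * g s - eps * q1 in
    let B := 2 * tau * s / Num.sqrt m - eps * q2 in
    2 * `|H| * Num.sqrt (1 + A ^+ 2 + B ^+ 2) ^+ 3 <
    graph_curvature A B
      (m * g1 s - kappa * s * g s - eps * (th - q1 ^+ 2))
      (tau * (1 + kappa * s ^+ 2) / m + eps * (q1 * q2))
      (- kappa * s * g s - eps * (th - q2 ^+ 2)) }.

(** [M] bounds the derivatives of [h + G(s)] on the interval and those of [ln
    (1 + P)], uniformly in [P]. *)
Lemma exists_barrier_profile (C H : R) : 0 < C -> 4 * H ^+ 2 + kappa <= 0 ->
  exists eps G g g1, is_barrier_profile C H eps G g g1.
Proof.
move=> C0 hH; have hk' := hk; have k0 : 0 <= 2 * `|H| by rewrite mulr_ge0.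
have hk2 : (2 * `|H|) ^+ 2 <= - kappa.
  by rewrite exprMn real_normK ?num_real //; lra.
have [mu [G [g [g1 [kmu hp]]]]] := exists_profile tau hk C0 k0 hk2.
have [M0 hM0] := profile_bounded hp.
have M00 : 0 <= M0 by have [|h _ _] := hM0 0; [rewrite normr0 ltW|exact: le_trans h].
pose K := 1 - kappa; have K1 : 1 <= K by rewrite /K; lra.
pose m1 := 1 - kappa * C ^+ 2.
have m11 : 1 <= m1 by rewrite /m1 lerDl oppr_ge0 mulr_le0_ge0 // sqr_ge0.
pose M := (m1 + K * C) * M0 + 2 * `|tau| * C + `|tau| * m1 + 2 * K.
have hgt : 0 <= 2 * `|H| < mu by rewrite k0 kmu.
have [e e0 he] := curvature_stable M hgt.
exists e, G, g, g1; split=> //; [exact: profile_der hp|exact: profile_der2 hp| |].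
  by exists M0 => s /hM0[].
move=> s q1 q2 P hs P0 hq; cbv zeta.
set m := 1 - kappa * s ^+ 2; set th := (1 - kappa * P) / (1 + P).
have hm1 : 1 <= m by rewrite /m lerDl oppr_ge0 mulr_le0_ge0 // sqr_ge0.
have hQ := profile_curvature hp hs.
have := he (Num.sqrt m * g s) (2 * tau * s / Num.sqrt m) (m * g1 s - kappa * s * g s)
  (tau * (1 + kappa * s ^+ 2) / m) (- kappa * s * g s) (- q1) (- q2)
  (- (th - q1 ^+ 2)) (q1 * q2) (- (th - q2 ^+ 2)).
rewrite !mulrN; apply; [ | |exact: hQ]; have [_ bg bg1] := hM0 s hs;
  clear he hp hQ hM0 hgt kmu hk2 k0 hH.
- have hs2 : s ^+ 2 <= C ^+ 2 by rewrite -real_normK ?num_real // ler_sqr ?nnegrE // ltW.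
  have hmm : m <= m1 by rewrite /m /m1 lerD2l lerN2 ler_wnM2l.
  have rt1 : 1 <= Num.sqrt m by have := ler_wsqrtr hm1; rewrite sqrtr1.
  have rtm : Num.sqrt m <= m1.
    apply: le_trans hmm; rewrite -[leRHS]sqr_sqrtr; last exact: le_trans hm1.
    by rewrite expr2 ler_peMr // (le_trans ler01).
  have C0' := ltW C0.
  have K0 : 0 <= K := le_trans ler01 K1.
  have m10 : 0 <= m1 := le_trans ler01 m11.
  have a1 : 0 <= m1 * M0 by rewrite mulr_ge0.
  have a2 : 0 <= K * C * M0 by rewrite !mulr_ge0.
  have a3 : 0 <= 2 * `|tau| * C by rewrite !mulr_ge0.
  have a4 : 0 <= `|tau| * m1 by rewrite mulr_ge0.
  have a5 : 0 <= 2 * K by rewrite mulr_ge0.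
  have a6 : 0 <= m1 * M0 + K * C * M0 by rewrite addr_ge0.
  have bskg : `|kappa * s * g s| <= K * C * M0.
    rewrite !normrM ler_pM ?mulr_ge0 // ler_pM // ler0_norm // /K.
    by rewrite lerDr.
  rewrite /M mulrDl; split.
  + have h : `|Num.sqrt m * g s| <= m1 * M0.
      by rewrite normrM ler_pM // ger0_norm // (le_trans ler01).
    by apply: (le_trans h); rewrite -!addrA lerDl !addr_ge0.
  + have h : `|2 * tau * s / Num.sqrt m| <= 2 * `|tau| * C.
      rewrite normrM normfV (ger0_norm (le_trans ler01 rt1)) ler_pdivrMr;
        last exact: lt_le_trans rt1.
      rewrite !normrM (ger0_norm (ler0n R 2)).
      apply: (@le_trans _ _ (2 * `|tau| * C)); first by rewrite ler_wpM2l // mulr_ge0.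
      by rewrite ler_peMr.
    apply: (le_trans h); rewrite -2!addrA [leRHS]addrCA lerDl !addr_ge0 //.
  + have h : `|m * g1 s - kappa * s * g s| <= m1 * M0 + K * C * M0.
      rewrite (le_trans (ler_normB _ _)) // lerD // normrM ler_pM // ger0_norm //.
      exact: le_trans hm1.
    by apply: (le_trans h); rewrite -!addrA lerD2l lerDl !addr_ge0.
  + have h : `|tau * (1 + kappa * s ^+ 2) / m| <= `|tau| * m1.
      rewrite -mulrA normrM ler_wpM2l //; apply: le_trans m11.
      rewrite normrM normfV (ger0_norm (le_trans ler01 hm1)) ler_pdivrMr ?mul1r;
        last exact: lt_le_trans hm1.
      have := mulr_le0_ge0 hk (sqr_ge0 s); rewrite ler_norml /m.
      by move: (kappa * _) => u hu; apply/andP; split; lra.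
    by apply: (le_trans h); rewrite -addrA addrC -addrA lerDl !addr_ge0.
  + have h : `|- kappa * s * g s| <= K * C * M0 by rewrite !mulNr normrN.
    by apply: (le_trans h); rewrite -!addrA addrCA lerDl !addr_ge0.
- have P1 : 0 < 1 + P by rewrite ltr_wpDr.
  have hK : K = 1 - kappa by [].
  have a6 : 2 * K <= M.
    have C0' := ltW C0; have K0 : 0 <= K := le_trans ler01 K1.
    have m10 : 0 <= m1 := le_trans ler01 m11.
    rewrite /M lerDr; move: (m1) (K) m10 K0 => u v u0 v0.
    by rewrite !(addr_ge0, mulr_ge0).
  have bK : [/\ `|q1| <= K, `|q2| <= K &
      [/\ `|th - q1 ^+ 2| <= K, `|th - q2 ^+ 2| <= K & `|q1 * q2| <= K]].
    move: hK hk' K1 hq P0 P1; rewrite /th; move: (K).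
    clear; move=> K -> hk K1 hq P0 P1.
    have q_bound : q1 ^+ 2 + q2 ^+ 2 <= 1 - kappa.
      rewrite -(ler_pM2r (exprn_gt0 2 P1)) hq; have := sqr_ge0 P; nra.
    have {hq} q1s := sqr_ge0 q1; have q2s := sqr_ge0 q2.
    have th0 : 0 <= (1 - kappa * P) / (1 + P) by rewrite divr_ge0; nra.
    have th1 : (1 - kappa * P) / (1 + P) <= 1 - kappa by rewrite ler_pdivrMr //; nra.
    move: th0 th1; move: (_ / _) => th th0 th1.
    have s1 := sqr_ge0 (q1 - q2); have s2 := sqr_ge0 (q1 + q2).
    by split; [| |split]; rewrite ler_norml; apply/andP; split; nra.
  case: bK => b1 b2 [b3 b4 b5].
  have KM : K <= M by apply: le_trans a6; rewrite ler_peMl // ?ler1n // (le_trans ler01).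
  by rewrite !normrN; split; apply: le_trans KM.
Qed.

End BarrierProfile.

(** * The barrier along a curve *)

Section Kinetic.
Context {R : realType} (kappa tau : R).
Implicit Types x y : R.
Local Notation lam := (conf kappa).

(** The connection form: the vertical component of the vector [(v0, v1, v2)]
    at [(x, y)]. *)
Definition contact x y v0 v1 v2 : R := v2 + tau * lam x y * (y * v0 - x * v1).

(** The derivatives of the conformal factor and of the connection form in the
    direction [v]. *)
Definition dlam x y v0 v1 : R := - (lam x y ^+ 2 * (kappa / 2 * (x * v0 + y * v1))).

Definition dcontact x y v0 v1 w0 w1 : R :=
  tau * (dlam x y v0 v1 * (y * w0 - x * w1) + lam x y * (v1 * w0 - v0 * w1)).

(** The derivative of the metric [(D_v g)(n, v) - (D_n g)(v, v) / 2], that is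
    the pairing of [n] with the quadratic part of the geodesic equation; [en]
    and [ev] are the vertical components of [n] and [v]. *)
Definition kinetic x y n0 n1 en v0 v1 ev : R :=
  2 * lam x y * dlam x y v0 v1 * (n0 * v0 + n1 * v1)
  - lam x y * dlam x y n0 n1 * (v0 ^+ 2 + v1 ^+ 2)
  + en * dcontact x y v0 v1 v0 v1
  + ev * (dcontact x y v0 v1 n0 n1 - dcontact x y n0 n1 v0 v1).

(** The exterior derivative of the connection form is [- 2 tau] times the area
    form of the base. *)
Lemma dcontact_antisym x y v0 v1 n0 n1 : in_base kappa x y ->
  dcontact x y v0 v1 n0 n1 - dcontact x y n0 n1 v0 v1 =
  2 * tau * lam x y ^+ 2 * (v1 * n0 - v0 * n1).
Proof.
move=> h; have d0 : 1 + kappa / 4 * (x ^+ 2 + y ^+ 2) != 0 by rewrite gt_eqF.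
rewrite /dcontact /dlam /conf; field.
by move: d0; apply: contraNneq => e; apply/eqP; lra.
Qed.

Lemma kineticZ x y r n0 n1 en v0 v1 ev :
  kinetic x y (r * n0) (r * n1) (r * en) v0 v1 ev = r * kinetic x y n0 n1 en v0 v1 ev.
Proof. by rewrite /kinetic /dcontact /dlam; ring. Qed.

End Kinetic.

Section Barrier.
Context {R : realType} (kappa tau a b c eps : R) (w : R -> R -> R) (G g g1 : R -> R).
Hypothesis hk : kappa <= 0.
Hypothesis hw : is_height kappa tau a b c w.
Implicit Types x y : R.

Local Notation disc := (in_base kappa).
Local Notation lam := (conf kappa).
Local Notation pot := (radial kappa).
Local Notation sig := (linear_fn kappa a b c).
Local Notation sigx := (linear_fn_x kappa a b c).
Local Notation sigy := (linear_fn_y kappa a b c).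
Local Notation twist := (twist kappa tau a b c).
Local Notation contact := (contact kappa tau).

(** The perturbation by [ln (1 + P)] makes the superlevel sets compact over
    the region where the height and [linear_fn] are bounded. *)
Definition barrier x y z : R := z + w x y + G (sig x y) - eps * ln (1 + pot x y).

(** The horizontal components, in coordinates, of the differential of
    [barrier]. *)
Definition barrier_x x y : R := - (twist x y * sigy x y) + g (sig x y) * sigx x y
  - eps * (lam x y ^+ 2 * x * (1 + pot x y)^-1).
Definition barrier_y x y : R := twist x y * sigx x y + g (sig x y) * sigy x y
  - eps * (lam x y ^+ 2 * y * (1 + pot x y)^-1).

Definition dbarrier x y v0 v1 v2 : R :=
  contact x y v0 v1 v2 + barrier_x x y * v0 + barrier_y x y * v1.

(** The symmetrised covariant derivative, on the base, of the form
    [(barrier_x, barrier_y)]. *)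
Definition barrier_hess x y v0 v1 : R :=
  let s := sig x y in let sv := sigx x y * v0 + sigy x y * v1 in
  let q := lam x y ^+ 2 * (v0 ^+ 2 + v1 ^+ 2) in
  2 * tau * (1 + kappa * s ^+ 2) / (1 - kappa * s ^+ 2) ^+ 2
    * (sv * (sigx x y * v1 - sigy x y * v0))
  + g1 s * sv ^+ 2 - kappa * s * g s * q
  - eps * ((1 - kappa * pot x y) / (1 + pot x y) * q
           - (lam x y ^+ 2 * (x * v0 + y * v1) / (1 + pot x y)) ^+ 2).

Lemma radial_ge0 x y : disc x y -> 0 <= pot x y.
Proof.
move=> h; have l0 := conf_gt0 h.
by rewrite /radial divr_ge0 // mulr_ge0 ?addr_ge0 ?sqr_ge0 // ltW.
Qed.

Lemma der_barrier (x y z : R -> R) (t x1 y1 z1 : R) :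
  is_derive t 1 x x1 -> is_derive t 1 y y1 -> is_derive t 1 z z1 ->
  disc (x t) (y t) ->
  is_derive (sig (x t) (y t)) 1 G (g (sig (x t) (y t))) ->
  is_derive t 1 (fun s => barrier (x s) (y s) (z s)) (dbarrier (x t) (y t) x1 y1 z1).
Proof.
move=> hx hy hz hd hG; have dw := height_der hw hx hy hd.
have ds := der_linear_fn hx hy hd a b c; have dp := der_radial hx hy hd.
have dG := @der_comp _ G (fun s => sig (x s) (y s)) _ _ _ hG ds; have p0 := radial_ge0 hd.
have p1 : 0 < 1 + pot (x t) (y t) by lra.
have dl : is_derive t 1 (fun s => ln (1 + pot (x s) (y s)))
  ((1 + pot (x t) (y t))^-1 * (0 + lam (x t) (y t) ^+ 2 * (x t * x1 + y t * y1))).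
  notypeclasses refine (@der_comp _ (@ln R) (fun s => 1 + pot (x s) (y s)) _ _ _ _ _).
    exact: is_derive1_ln.
  by der.
notypeclasses refine (is_derive_eq _ _); first by rewrite /barrier; der.
rewrite /dbarrier /contact /barrier_x /barrier_y /height_form; by ring.
Qed.

Section SecondOrder.
Variables (x y x1 y1 z1 : R -> R) (x2 y2 z2 : R).
Hypothesis hx : is_derive (0 : R) (1 : R) x (x1 0).
Hypothesis hy : is_derive (0 : R) (1 : R) y (y1 0).
Hypothesis hx1 : is_derive (0 : R) (1 : R) x1 x2.
Hypothesis hy1 : is_derive (0 : R) (1 : R) y1 y2.
Hypothesis hz1 : is_derive (0 : R) (1 : R) z1 z2.
Hypothesis hd : disc (x 0) (y 0).
Hypothesis hg : is_derive (sig (x 0) (y 0)) 1 g (g1 (sig (x 0) (y 0))).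

(** The second derivative along a curve splits into the acceleration paired
    with the gradient [n] of the barrier, completed by [kinetic] into a
    covariant derivative, the Hessian of the base, and a mixed term due to the
    bundle curvature. *)
Lemma der_dbarrier :
  is_derive (0 : R) (1 : R) (fun t => dbarrier (x t) (y t) (x1 t) (y1 t) (z1 t))
   (dbarrier (x 0) (y 0) x2 y2 z2
    + kinetic kappa tau (x 0) (y 0)
       (barrier_x (x 0) (y 0) / lam (x 0) (y 0) ^+ 2)
       (barrier_y (x 0) (y 0) / lam (x 0) (y 0) ^+ 2) 1
       (x1 0) (y1 0) (contact (x 0) (y 0) (x1 0) (y1 0) (z1 0))
    + barrier_hess (x 0) (y 0) (x1 0) (y1 0)
    + 2 * tau * contact (x 0) (y 0) (x1 0) (y1 0) (z1 0)
      * (barrier_y (x 0) (y 0) * x1 0 - barrier_x (x 0) (y 0) * y1 0)).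
Proof.
have ds := der_linear_fn hx hy hd a b c; have dp := der_radial hx hy hd.
have dsx := der_linear_fn_x hx hy hd a b c; have dsy := der_linear_fn_y hx hy hd a b c.
have dl := der_conf hx hy hd; have dg := @der_comp _ g (fun s =>
  sig (x s) (y s)) _ _ _ hg ds.
have l0 := conf_gt0 hd; have p0 := radial_ge0 hd.
have p1 : 0 < 1 + pot (x 0) (y 0) by lra.
have m0 := twist_denom_gt0 a b c hk (x 0) (y 0).
have dip : is_derive (0 : R) (1 : R) (fun s => (1 + pot (x s) (y s))^-1)
  (- (1 + pot (x 0) (y 0)) ^- 2 *
   (0 + lam (x 0) (y 0) ^+ 2 * (x 0 * x1 0 + y 0 * y1 0))).
  notypeclasses refine (@derV _ (fun s => 1 + pot (x s) (y s)) _ _ _ _).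
    by rewrite gt_eqF.
  by der.
have dim : is_derive (0 : R) (1 : R) (fun s => (1 - kappa * sig (x s) (y s) ^+ 2)^-1)
  (- (1 - kappa * sig (x 0) (y 0) ^+ 2) ^- 2 *
   (0 + - (0 * sig (x 0) (y 0) ^+ 2 + kappa * (2 * sig (x 0) (y 0) *
     (sigx (x 0) (y 0) * x1 0 + sigy (x 0) (y 0) * y1 0))))).
  notypeclasses refine (@derV _ (fun s => 1 - kappa * sig (x s) (y s) ^+ 2) _ _ _ _).
    by rewrite gt_eqF.
  by der.
notypeclasses refine (is_derive_eq _ _).
  by rewrite /dbarrier /contact /barrier_x /barrier_y /twist; der.
rewrite /kinetic dcontact_antisym // /barrier_hess /dbarrier /contact /dcontact.
rewrite /barrier_x /barrier_y /twist /dlam.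
move: p1 m0 l0; rewrite /radial; move: (lam _ _) (sig _ _) (sigx _ _) (sigy _ _).
move=> l u sx sy p1 m0 l0.
have p2 : 0 < 2 + l * (x 0 ^+ 2 + y 0 ^+ 2) by lra.
by field; rewrite (gt_eqF p2) (gt_eqF m0) (gt_eqF l0).
Qed.

End SecondOrder.
End Barrier.

(** * The Levi-Civita connection of E(kappa, tau) *)

Section Connection.
Context {R : realType} (kappa tau : R).
Implicit Types p v w u : 'rV[R]_3.

Let g := Ekt_metric kappa tau.
Local Notation X p := (p 0 0) (only parsing).
Local Notation Y p := (p 0 1) (only parsing).
Local Notation lamp p := (conf kappa (p 0 0) (p 0 1)).

Definition vert p v : R := contact kappa tau (p 0 0) (p 0 1) (v 0 0) (v 0 1) (v 0 2).

Lemma inner_Ekt p v w : inner g p v w =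
  lamp p ^+ 2 * (v 0 0 * w 0 0 + v 0 1 * w 0 1) + vert p v * vert p w.
Proof.
have etaE q : (q *m (Ekt_eta kappa tau p)^T) 0 0 = vert p q.
  rewrite mxE sum3 !mxE /= /vert /contact /Ekt_lambda /Ekt_denom -/(lamp p).
  by ring.
by rewrite /g Ekt_innerE !etaE.
Qed.

(** Lowering the index of the Christoffel symbols cancels the inverse of the
    metric: Koszul's formula. *)
Lemma inner_connection_sum (h : 'rV[R]_3 -> 'M[R]_3) p v w u :
  h p \in unitmx -> (h p)^T = h p ->
  inner h p (connection h p v w) u = 2^-1 * \sum_l (\sum_i \sum_j
    (partial i (fun q => h q j l) p + partial j (fun q => h q i l) p
     - partial l (fun q => h q i j) p) * v 0 i * w 0 j) * u 0 l.
Proof.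
move=> hu hs.
pose r := \row_l (\sum_i \sum_j
    (partial i (fun q => h q j l) p + partial j (fun q => h q i l) p
     - partial l (fun q => h q i j) p) * v 0 i * w 0 j).
have -> : connection h p v w = 2^-1 *: (r *m (invmx (h p))^T).
  apply/rowP => k; rewrite !mxE mulr_sumr.
  under [RHS]eq_bigr => l _ do rewrite !mxE mulr_suml mulr_sumr.
  rewrite [RHS]exchange_big /=; apply: eq_bigr => i _.
  under [RHS]eq_bigr => l _ do rewrite mulr_suml mulr_sumr.
  rewrite [RHS]exchange_big /=; apply: eq_bigr => j _.
  rewrite /christoffel mulr_sumr !mulr_suml.
  apply: eq_bigr => l _; by field.
rewrite /inner -scalemxAl -scalemxAl -!mulmxA trmx_inv hs.
rewrite (mulmxA (invmx _)) mulVmx // mul1mx mxE mxE; congr (_ * _).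
by apply: eq_bigr => l _; rewrite !mxE.
Qed.

(** [(D_v g)(w, u)]. *)
Definition dmetric p v w u : R :=
  2 * lamp p * dlam kappa (X p) (Y p) (v 0 0) (v 0 1) * (w 0 0 * u 0 0 + w 0 1 * u 0 1)
  + dcontact kappa tau (X p) (Y p) (v 0 0) (v 0 1) (w 0 0) (w 0 1) * vert p u
  + vert p w * dcontact kappa tau (X p) (Y p) (v 0 0) (v 0 1) (u 0 0) (u 0 1).

Let E p (i j l : 'I_3) : R := dmetric p (delta_mx 0 i) (delta_mx 0 j) (delta_mx 0 l).

Lemma partial_metric p i j l : Ekt kappa p -> partial i (fun q => g q j l) p = E p i j l.
Proof.
move=> Ep.
have gE q : g q j l = Ekt_lambda kappa q ^+ 2 * (pid_mx 2 : 'M[R]_3) j l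
    + Ekt_eta kappa tau q 0 j * Ekt_eta kappa tau q 0 l.
  by rewrite /g /Ekt_metric !mxE big_ord1 !mxE.
have hl := is_derive_lambda (delta_mx 0 i) Ep.
have hj := is_derive_eta tau (delta_mx 0 i) j Ep.
have hl' := is_derive_eta tau (delta_mx 0 i) l Ep.
have : is_derive p (delta_mx 0 i) (fun q => g q j l) (E p i j l).
  notypeclasses refine (is_derive_ext (is_deriveD (is_deriveM (is_deriveM hl hl)
    (is_derive_cst ((pid_mx 2 : 'M[R]_3) j l) p (delta_mx 0 i))) (is_deriveM hj hl')) _ _).
    by move=> q; rewrite gE /= !fctE expr2.
  rewrite /GRing.scale /= /E /dmetric /vert /contact /dcontact /dlam.
  case: i {hl hj hl' gE} => -[|[|[|//]]] hi; case: j => -[|[|[|//]]] hj;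
  case: l => -[|[|[|//]]] hl; rewrite !mxE /= ?fctE /Ekt_lambda /Ekt_denom;
  rewrite -?/(lamp p); move: (lamp p) => L; by field.
by case.
Qed.

Lemma inner_connection p v w u : Ekt kappa p ->
  inner g p (connection g p v w) u =
  2^-1 * (dmetric p v w u + dmetric p w v u - dmetric p u v w).
Proof.
move=> Ep; rewrite inner_connection_sum ?Ekt_metric_unit // ?Ekt_metric_sym //.
congr (_ * _).
under eq_bigr => l _ do under eq_bigr => i _ do under eq_bigr => j _ do
  rewrite !partial_metric //.
rewrite !sum3 /E /dmetric /vert /contact /dcontact /dlam !mxE /=.
move: (lamp p) => L; by ring.
Qed.

End Connection.

(** * Second variation along a surface *)

Section Lines.
Context {R : realType}.

Lemma der_coord (F : R -> 'rV[R]_3) (t : R) (d : 'rV[R]_3) (j : 'I_3) :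
  is_derive t 1 F d -> is_derive t 1 (fun s : R => F s 0 j : R) (d 0 j).
Proof.
case=> hF hd; have hFj : derivable (fun s : R => F s 0 j : R) t 1.
  by move/derivable_mxP : hF; exact.
by apply: DeriveDef => //; rewrite -hd derive_mx // mxE.
Qed.

Lemma derive_partial (Y : 'rV[R]_2 -> 'rV[R]_3) (p v : 'rV[R]_2) :
  differentiable Y p -> 'D_v Y p = \sum_i v 0 i *: partial i Y p.
Proof.
move=> hY; rewrite deriveEjacobian // mulmx_sum_row.
by apply: eq_bigr => i _; rewrite /partial deriveEjacobian // -rowE.
Qed.

(** The difference quotients of both sides are the same function. *)
Lemma der_line (Y : 'rV[R]_2 -> 'rV[R]_3) (u v : 'rV[R]_2) (t : R) :
  differentiable Y (u + t *: v) ->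
  is_derive t 1 (fun s : R => Y (u + s *: v)) (\sum_i v 0 i *: partial i Y (u + t *: v)).
Proof.
move=> hY; rewrite -(derive_partial v hY).
have e : (fun h : R => h^-1 *: (((fun s : R => Y (u + s *: v)) \o shift t) (h *: 1)
      - Y (u + t *: v))) =
    (fun h : R => h^-1 *: ((Y \o shift (u + t *: v)) (h *: v) - Y (u + t *: v))).
  apply/funext => h /=; have -> : h *: (1 : R) = h by rewrite /GRing.scale /= mulr1.
  rewrite scalerDl.
  by congr (_ *: (Y _ - _)); rewrite addrCA.
have hD : derivable Y (u + t *: v) v by exact: diff_derivable.
by apply: DeriveDef; [rewrite /derivable e|rewrite /derive e].
Qed.

Lemma tangent_frameE (X : 'rV[R]_2 -> 'rV[R]_3) (u v : 'rV[R]_2) :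
  v *m tangent_frame X u = \sum_i v 0 i *: partial i X u.
Proof.
rewrite mulmx_sum_row; apply: eq_bigr => i _; congr (_ *: _).
by apply/rowP => j; rewrite !mxE.
Qed.

End Lines.

Section SecondVariation.
Context {R : realType} (kappa tau : R).
Local Notation g := (Ekt_metric kappa tau).
Local Notation eta := (vert kappa tau).
Implicit Types p v w : 'rV[R]_3.

Lemma sum2 (V : nmodType) (F : 'I_2 -> V) : \sum_i F i = F 0 + F 1.
Proof.
by rewrite !big_ord_recl big_ord0 addr0; congr (F _ + F _); exact/val_inj.
Qed.

Lemma inner_addl (h : 'rV[R]_3 -> 'M[R]_3) p v w u :
  inner h p (v + w) u = inner h p v u + inner h p w u.
Proof. by rewrite /inner !mulmxDl mxE. Qed.

Lemma inner_addr (h : 'rV[R]_3 -> 'M[R]_3) p v w u :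
  inner h p u (v + w) = inner h p u v + inner h p u w.
Proof. by rewrite /inner raddfD /= mulmxDr mxE. Qed.

Lemma inner_scalel (h : 'rV[R]_3 -> 'M[R]_3) p r v u :
  inner h p (r *: v) u = r * inner h p v u.
Proof. by rewrite /inner -!scalemxAl mxE. Qed.

Lemma inner_scaler (h : 'rV[R]_3 -> 'M[R]_3) p r v u :
  inner h p u (r *: v) = r * inner h p u v.
Proof. by rewrite /inner linearZ /= -scalemxAr mxE. Qed.

Lemma inner_mulmxr (h : 'rV[R]_3 -> 'M[R]_3) p u m (v : 'rV[R]_m) (M : 'M[R]_(m, 3)) :
  inner h p u (v *m M) = \sum_i v 0 i * inner h p u (row i M).
Proof.
rewrite /inner trmx_mul mulmxA mxE; apply: eq_bigr => i _.
rewrite mulrC mxE; congr (_ * _); rewrite !mxE.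
by apply: eq_bigr => j _; rewrite !mxE.
Qed.

Lemma connection_mulmx (h : 'rV[R]_3 -> 'M[R]_3) p n m (v : 'rV[R]_m) (M : 'M[R]_(m, 3)) :
  connection h p (v *m M) n = \sum_i v 0 i *: connection h p (row i M) n.
Proof.
apply/rowP => k; rewrite summxE mxE.
under [RHS]eq_bigr => l _ do rewrite !mxE mulr_sumr.
rewrite [RHS]exchange_big /=; apply: eq_bigr => i _.
under [RHS]eq_bigr => l _ do rewrite mulr_sumr.
rewrite [RHS]exchange_big /=; apply: eq_bigr => j _.
rewrite mxE mulr_sumr mulr_suml; apply: eq_bigr => l _.
by rewrite mxE; ring.
Qed.

Lemma der_inner (P V W : R -> 'rV[R]_3) (t : R) (P1 V1 W1 : 'rV[R]_3) :
  Ekt kappa (P t) -> is_derive t 1 P P1 -> is_derive t 1 V V1 -> is_derive t 1 W W1 ->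
  is_derive t 1 (fun s => inner g (P s) (V s) (W s))
    (dmetric kappa tau (P t) P1 (V t) (W t)
     + inner g (P t) V1 (W t) + inner g (P t) (V t) W1).
Proof.
move=> hE hP hV hW.
have dP j := der_coord j hP; have dV j := der_coord j hV; have dW j := der_coord j hW.
have hx := dP 0; have hy := dP 1.
have v0 := dV 0; have v1 := dV 1; have v2 := dV 2.
have w0 := dW 0; have w1 := dW 1; have w2 := dW 2.
have dl := der_conf hx hy hE.
rewrite !inner_Ekt; have -> : (fun s => inner g (P s) (V s) (W s)) = fun s =>
    conf kappa (P s 0 0) (P s 0 1) ^+ 2 * (V s 0 0 * W s 0 0 + V s 0 1 * W s 0 1)
    + eta (P s) (V s) * eta (P s) (W s).
  by apply/funext => s; rewrite inner_Ekt.
notypeclasses refine (is_derive_eq _ _); first by rewrite /vert /contact; der.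
rewrite /dmetric /vert /contact /dcontact /dlam; by ring.
Qed.

Lemma kinetic_dmetric p n v :
  dmetric kappa tau p v n v - 2^-1 * dmetric kappa tau p n v v =
  kinetic kappa tau (p 0 0) (p 0 1) (n 0 0) (n 0 1) (eta p n) (v 0 0) (v 0 1) (eta p v).
Proof. by rewrite /dmetric /kinetic; field. Qed.

(** Two of the three terms of Koszul's formula cancel when the last argument
    is the direction of differentiation. *)
Lemma inner_connection_tangent p n v : Ekt kappa p ->
  inner g p (connection g p v n) v = 2^-1 * dmetric kappa tau p n v v.
Proof.
move=> Ep; rewrite inner_connection //; congr (_ * _).
by rewrite /dmetric; ring.
Qed.

Section AtPoint.
Variables (U : set 'rV[R]_2) (X N : 'rV[R]_2 -> 'rV[R]_3) (u0 v : 'rV[R]_2) (A : 'M[R]_2).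
Hypothesis hX : smooth_on U X.
Hypothesis hE : forall u, U u -> Ekt kappa (X u).
Hypothesis hN : unit_normal g U X N.
Hypothesis hA : shape_operator g X N u0 A.
Hypothesis hu0 : U u0.

Let F := tangent_frame X u0.
Let Z u := \sum_i v 0 i *: partial i X u.

Lemma near_line : \forall t \near (0 : R), U (u0 + t *: v).
Proof.
have oU : nbhs u0 U by rewrite nbhsE; exists U => //; split => //; case: hX.
have c : {for (0 : R), continuous (fun t : R => u0 + t *: v)}.
  by apply: cvgD; [exact: cvg_cst|exact: scalel_continuous].
by apply: c; rewrite /= scale0r addr0.
Qed.

Let u0E : u0 + (0 : R) *: v = u0.
Proof. by rewrite scale0r addr0. Qed.

Let dX u : U u -> differentiable X u.
Proof. by case: hX => _ h /(h [::]). Qed.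

Let dN u : U u -> differentiable N u.
Proof. by case: hN => -[_ h] _ /(h [::]). Qed.

Let dXi i u : U u -> differentiable (partial i X) u.
Proof. by case: hX => _ h /(h [:: i]). Qed.

Lemma der_surface_line : \forall t \near (0 : R),
  is_derive (t : R) (1 : R) (fun s : R => X (u0 + s *: v)) (Z (u0 + t *: v)).
Proof.
by apply: filterS near_line => t /dX h; exact: der_line.
Qed.

(** Differentiating that the normal [N] is orthogonal to the tangent vector of
    the line turns the derivative of [N] in the shape operator into the
    acceleration [T1] of the line. *)
Lemma second_variation : exists T1 : 'rV[R]_3,
  is_derive (0 : R) (1 : R) (fun t : R => Z (u0 + t *: v)) T1 /\
  inner g (X u0) (v *m A *m F) (v *m F) = inner g (X u0) (N u0) T1 +
   kinetic kappa tau (X u0 0 0) (X u0 0 1) (N u0 0 0) (N u0 0 1) (eta (X u0) (N u0))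
    ((v *m F) 0 0) ((v *m F) 0 1) (eta (X u0) (v *m F)).
Proof.
have dZ : differentiable Z u0.
  have -> : Z = fun u => v 0 0 *: partial 0 X u + v 0 1 *: partial 1 X u.
    by apply/funext => u; rewrite /Z sum2.
  by apply: differentiableD; apply: differentiableZ; exact: dXi.
have h0 := u0E.
have hZ := @der_line _ Z u0 v 0; rewrite h0 in hZ; have {}hZ := hZ dZ.
have hXl := @der_line _ X u0 v 0; rewrite h0 in hXl; have {}hXl := hXl (dX hu0).
have hNl := @der_line _ N u0 v 0; rewrite h0 in hNl; have {}hNl := hNl (dN hu0).
rewrite -tangent_frameE -/F in hXl; set T1 := (\sum_i _) in hZ.
set N1 := (\sum_i _) in hNl.
exists T1; split=> //.
have ZE : Z u0 = v *m F by rewrite tangent_frameE.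
have hI := @der_inner (fun t => X (u0 + t *: v)) (fun t => N (u0 + t *: v))
  (fun t => Z (u0 + t *: v)) 0 (v *m F) N1 T1.
rewrite h0 ZE in hI; have {}hI := hI (hE hu0) hXl hNl hZ.
have normal u : U u -> inner g (X u) (N u) (Z u) = 0.
  move=> hu; have [_ /(_ u hu)[_ h]] := hN.
  rewrite /Z -tangent_frameE inner_mulmxr big1 // => i _.
  have -> : row i (tangent_frame X u) = partial i X u.
    by apply/rowP => k; rewrite !mxE.
  by rewrite h mulr0.
have hI0 : is_derive (0 : R) (1 : R)
    (fun t => inner g (X (u0 + t *: v)) (N (u0 + t *: v)) (Z (u0 + t *: v))) 0.
  notypeclasses refine (near_eq_is_derive _ (derC (0 : R) (0 : R))).
  by apply: filterS near_line => t ht; rewrite normal.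
have e0 := der_eq hI hI0.
have shape : v *m A *m F = - (N1 + connection g (X u0) (v *m F) (N u0)).
  have connE : connection g (X u0) (v *m F) (N u0) =
      \sum_i v 0 i *: connection g (X u0) (partial i X u0) (N u0).
    rewrite connection_mulmx; apply: eq_bigr => i _; congr (_ *: connection _ _ _ _).
    by apply/rowP => k; rewrite !mxE.
  rewrite connE /N1 -big_split /= -sumrN -mulmxA mulmx_sum_row.
  apply: eq_bigr => i _; rewrite -scalerDr -scalerN hA; congr (_ *: _).
  rewrite row_mul mulmx_sum_row; apply: eq_bigr => j _.
  by rewrite mxE; congr (_ *: _); apply/rowP => k; rewrite !mxE.
rewrite shape -scaleN1r inner_scalel inner_addl inner_connection_tangent //; last exact: hE.
rewrite -kinetic_dmetric mulN1r.
by lra.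
Qed.

End AtPoint.
End SecondVariation.

(** * An H-surface is not tangent to a level set at a maximum of the barrier *)

Section NoMaximum.
Context {R : realType} (kappa tau a b c H C eps : R) (w : R -> R -> R) (G g g1 : R -> R).
Hypothesis hk : kappa <= 0.
Hypothesis hn : a ^+ 2 + b ^+ 2 + kappa * c ^+ 2 = 1.
Hypothesis hw : is_height kappa tau a b c w.
Hypothesis hb : is_barrier_profile kappa tau C H eps G g g1.

Local Notation gE := (Ekt_metric kappa tau).
Local Notation sigp p := (linear_fn kappa a b c (p 0 0) (p 0 1)).

Definition barrier_at (p : 'rV[R]_3) : R :=
  barrier kappa a b c eps w G (p 0 0) (p 0 1) (p 0 2).

Local Notation b_x x y := (barrier_x kappa tau a b c eps g x y).
Local Notation b_y x y := (barrier_y kappa tau a b c eps g x y).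
Local Notation db := (dbarrier kappa tau a b c eps g).
Local Notation hess := (barrier_hess kappa tau a b c eps g g1).
Local Notation ctc := (contact kappa tau).
Local Notation lam := (conf kappa).

Variables (U : set 'rV[R]_2) (X N : 'rV[R]_2 -> 'rV[R]_3) (u0 : 'rV[R]_2) (S : 'M[R]_2).
Hypothesis hX : smooth_on U X.
Hypothesis hE : forall u, U u -> Ekt kappa (X u).
Hypothesis hN : unit_normal gE U X N.
Hypothesis hu0 : U u0.
Hypothesis hfree : row_free (tangent_frame X u0).
Hypothesis hS : shape_operator gE X N u0 S.
Hypothesis hH : \tr S / 2 = H.
Hypothesis hC : forall u, U u -> `|sigp (X u)| <= C.
Hypothesis hmax : forall u, U u -> barrier_at (X u) <= barrier_at (X u0).

Let F := tangent_frame X u0.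
Let p := X u0.
Let x := p 0 0.
Let y := p 0 1.

(** First and second order conditions at the maximum along a line of the
    chart, next to the second fundamental form in the same direction. *)
Lemma line_variation (v : 'rV[R]_2) : let T := v *m F in
  db x y (T 0 0) (T 0 1) (T 0 2) = 0 /\ exists T1 : 'rV[R]_3,
  db x y (T1 0 0) (T1 0 1) (T1 0 2)
    + kinetic kappa tau x y (b_x x y / lam x y ^+ 2) (b_y x y / lam x y ^+ 2) 1
       (T 0 0) (T 0 1) (ctc x y (T 0 0) (T 0 1) (T 0 2))
    + hess x y (T 0 0) (T 0 1)
    + 2 * tau * ctc x y (T 0 0) (T 0 1) (T 0 2)
      * (b_y x y * T 0 0 - b_x x y * T 0 1) <= 0 /\
  inner gE p (v *m S *m F) T = inner gE p (N u0) T1 +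
   kinetic kappa tau x y (N u0 0 0) (N u0 0 1) (vert kappa tau p (N u0))
    (T 0 0) (T 0 1) (vert kappa tau p T).
Proof.
cbv zeta; have [T1 [dZ eII]] := second_variation v hX hE hN hS hu0.
pose Z u := \sum_i v 0 i *: partial i X u.
have Z0 : Z (u0 + (0 : R) *: v) = v *m F by rewrite scale0r addr0 /Z -tangent_frameE.
have X0 : X (u0 + (0 : R) *: v) = p by rewrite scale0r addr0.
have near1 := der_surface_line v hX hu0; have nearU := near_line v hX hu0.
pose f t := barrier_at (X (u0 + t *: v)).
pose f1 t := db (X (u0 + t *: v) 0 0) (X (u0 + t *: v) 0 1)
   (Z (u0 + t *: v) 0 0) (Z (u0 + t *: v) 0 1) (Z (u0 + t *: v) 0 2).
have h1 : \forall t \near (0 : R), is_derive (t : R) (1 : R) f (f1 t).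
  near=> t; have hUt : U (u0 + t *: v) by near: t.
  have hXt : is_derive t 1 (fun s : R => X (u0 + s *: v)) (Z (u0 + t *: v)) by near: t.
  have d0 := der_coord 0 hXt; have d1 := der_coord 1 hXt; have d2 := der_coord 2 hXt.
  apply: (der_barrier eps hw d0 d1 d2 (hE hUt)).
  exact: (barrier_der hb (hC hUt)).
have hX0 := nbhs_singleton near1.
have d0 := der_coord 0 hX0; have d1 := der_coord 1 hX0.
have z0 := der_coord 0 dZ; have z1 := der_coord 1 dZ; have z2 := der_coord 2 dZ.
have hd0 : in_base kappa (X (u0 + (0 : R) *: v) 0 0) (X (u0 + (0 : R) *: v) 0 1).
  by rewrite X0; exact: hE.
have hC0 : `|sigp (X (u0 + (0 : R) *: v))| <= C by rewrite X0; exact: hC.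
have h2 := der_dbarrier tau eps hk d0 d1 z0 z1 z2 hd0 (barrier_der2 hb hC0).
have h3 : \forall t \near (0 : R), f t <= f 0.
  by apply: filterS nearU => t /hmax; rewrite /f X0.
have [e1 e2] := der_local_max h1 h2 h3.
move: e1 e2; rewrite /f1 !X0 -/(Z _) !Z0 => e1 e2.
by split=> //; exists T1; split=> //.
Unshelve. all: by end_near. Qed.

Let l := lam x y.
Let s := linear_fn kappa a b c x y.
Let m := 1 - kappa * s ^+ 2.
Let rt := Num.sqrt m.
Let o1 := linear_fn_x kappa a b c x y / (l * rt).
Let o2 := linear_fn_y kappa a b c x y / (l * rt).
Let P := radial kappa x y.
Let q1 := l * (x * o1 + y * o2) / (1 + P).
Let q2 := l * (y * o1 - x * o2) / (1 + P).
Let A := rt * g s - eps * q1.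
Let B := 2 * tau * s / rt - eps * q2.

Let hd : in_base kappa x y := hE hu0.
Let l0 : 0 < l := conf_gt0 hd.
Let m0 : 0 < m := twist_denom_gt0 a b c hk x y.
Let rt0 : 0 < rt.
Proof. by rewrite sqrtr_gt0. Qed.
Let rt2 : rt ^+ 2 = m.
Proof. by rewrite sqr_sqrtr // ltW. Qed.
Let sxE : linear_fn_x kappa a b c x y = l * rt * o1.
Proof. by rewrite /o1 mulrC divfK // gt_eqF // mulr_gt0. Qed.
Let syE : linear_fn_y kappa a b c x y = l * rt * o2.
Proof. by rewrite /o2 mulrC divfK // gt_eqF // mulr_gt0. Qed.
Let o_unit : o1 ^+ 2 + o2 ^+ 2 = 1.
Proof.
have h := linear_fn_grad_norm hd hn.
rewrite /o1 /o2 !expr_div_n -mulrDl h -/l -/s -/m exprMn rt2 divff //.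
by rewrite gt_eqF // mulr_gt0 // exprn_gt0.
Qed.
Let P1 : 0 < 1 + P.
Proof. by rewrite ltr_wpDr // radial_ge0. Qed.

Let bxE : b_x x y = l * (A * o1 - B * o2).
Proof.
rewrite /barrier_x /twist sxE syE -/s -/l -/P -/m /A /B -rt2.
have e1 : l ^+ 2 * x / (1 + P) = l * (q1 * o1 - q2 * o2).
  have -> : x = x * (o1 ^+ 2 + o2 ^+ 2) by rewrite o_unit mulr1.
  by rewrite /q1 /q2; field; rewrite gt_eqF.
by rewrite e1; field; rewrite gt_eqF.
Qed.

Let byE : b_y x y = l * (A * o2 + B * o1).
Proof.
rewrite /barrier_y /twist sxE syE -/s -/l -/P -/m /A /B -rt2.
have e1 : l ^+ 2 * y / (1 + P) = l * (q1 * o2 + q2 * o1).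
  have -> : y = y * (o1 ^+ 2 + o2 ^+ 2) by rewrite o_unit mulr1.
  by rewrite /q1 /q2; field; rewrite gt_eqF.
by rewrite e1; field; rewrite gt_eqF.
Qed.

(** The lift of a vector of the base into the kernel of the differential of
    the barrier. *)
Let hlift (t0 t1 : R) : 'rV[R]_3 := \row_j [:: t0; t1;
  - (b_x x y * t0 + b_y x y * t1) - tau * l * (y * t0 - x * t1)]`_j.
(** In the orthonormal frame of the base along ([o1, o2]) and across the
    gradient of [linear_fn], the gradient of the barrier has components [A]
    and [B]; [E1] and [E2] lift this frame to the tangent plane. *)
Let E1 := hlift (o1 / l) (o2 / l).
Let E2 := hlift (- o2 / l) (o1 / l).

Let ctc_lift t0 t1 : vert kappa tau p (hlift t0 t1) = - (b_x x y * t0 + b_y x y * t1).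
Proof. by rewrite /vert /contact !mxE /= -/x -/y -/l; ring. Qed.

Let eta1 : vert kappa tau p E1 = - A.
Proof.
rewrite ctc_lift bxE byE -[in RHS](mulr1 A) -o_unit.
by field; rewrite gt_eqF.
Qed.

Let eta2 : vert kappa tau p E2 = - B.
Proof.
rewrite ctc_lift bxE byE -[in RHS](mulr1 B) -o_unit.
by field; rewrite gt_eqF.
Qed.

(** The tangent plane of the surface lies in the kernel of the differential of
    the barrier, and both have dimension 2. *)
Let lifts t0 t1 : exists v, v *m F = hlift t0 t1.
Proof.
pose d : 'cV[R]_3 := \col_j [:: b_x x y + tau * l * y; b_y x y - tau * l * x; 1]`_j.
have dbE (T : 'rV[R]_3) : db x y (T 0 0) (T 0 1) (T 0 2) = (T *m d) 0 0.
  by rewrite mxE sum3 !mxE /= /dbarrier /contact -/l; ring.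
have Fd : F *m d = 0.
  apply/row_matrixP => i; rewrite row_mul rowE -mulmxA.
  have [h _] := line_variation (delta_mx 0 i).
  by apply/matrixP => j k; rewrite !ord1 mulmxA -dbE h !mxE.
have FK : (F <= kermx d)%MS by apply/sub_kermxP.
have rd : \rank d = 1%N.
  apply/eqP; rewrite eqn_leq rank_leq_col lt0n mxrank_eq0 /=.
  apply/eqP => /matrixP /(_ 2 0); rewrite !mxE /= => /eqP; by rewrite oner_eq0.
have rF : \rank F = 2%N by apply/eqP.
have KF : (kermx d <= F)%MS.
  by rewrite -(geq_leqif (mxrank_leqif_sup FK)) mxrank_ker rd rF.
have LK : (hlift t0 t1 <= kermx d)%MS.
  apply/sub_kermxP/matrixP => i j; rewrite !ord1 mxE sum3 !mxE /=.
  by ring.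
by have /submxP[v ->] := submx_trans LK KF; exists v.
Qed.

Let inner_lift t0 t1 v0 v1 : inner gE p (hlift t0 t1) (hlift v0 v1) =
  l ^+ 2 * (t0 * v0 + t1 * v1) + vert kappa tau p (hlift t0 t1) *
    vert kappa tau p (hlift v0 v1).
Proof. by rewrite inner_Ekt !mxE. Qed.

Let i11 : inner gE p E1 E1 = 1 + A ^+ 2.
Proof.
rewrite inner_lift eta1 -{1}o_unit; by field; rewrite gt_eqF.
Qed.
Let i12 : inner gE p E1 E2 = A * B.
Proof. rewrite inner_lift eta1 eta2; by field; rewrite gt_eqF. Qed.
Let i21 : inner gE p E2 E1 = A * B.
Proof. rewrite inner_lift eta1 eta2; by field; rewrite gt_eqF. Qed.
Let i22 : inner gE p E2 E2 = 1 + B ^+ 2.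
Proof.
rewrite inner_lift eta2 -{1}o_unit; by field; rewrite gt_eqF.
Qed.

(** The normal is parallel to the gradient of the barrier, and the vertical
    component of the gradient is [1]: so [N] is [nu] times the gradient, and
    [nu^2 W^2 = 1]. *)
Let nu := vert kappa tau p (N u0).

Let normal_lift t0 t1 : inner gE p (N u0) (hlift t0 t1) = 0.
Proof.
have [v <-] := lifts t0 t1; rewrite inner_mulmxr big1 // => i _.
have -> : row i F = partial i X u0 by apply/rowP => k; rewrite !mxE.
by have [_ /(_ _ hu0)[_ h]] := hN; rewrite h mulr0.
Qed.

Let N0 : N u0 0 0 = nu * (b_x x y / l ^+ 2).
Proof.
have := normal_lift 1 0; rewrite inner_Ekt ctc_lift !mxE /= -/nu -/x -/y -/l.
rewrite !mulr0 !addr0 !mulr1 mulrN => /eqP; rewrite subr_eq0 => /eqP h.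
by rewrite mulrA -h; field; rewrite gt_eqF.
Qed.

Let N1 : N u0 0 1 = nu * (b_y x y / l ^+ 2).
Proof.
have := normal_lift 0 1; rewrite inner_Ekt ctc_lift !mxE /= -/nu -/x -/y -/l.
rewrite !mulr0 !add0r !mulr1 mulrN => /eqP; rewrite subr_eq0 => /eqP h.
by rewrite mulrA -h; field; rewrite gt_eqF.
Qed.

Let nu2 : nu ^+ 2 * (1 + A ^+ 2 + B ^+ 2) = 1.
Proof.
have [_ /(_ _ hu0)[h _]] := hN; rewrite -[RHS]h inner_Ekt -/nu -/x -/y -/l N0 N1 bxE byE.
have -> : 1 + A ^+ 2 + B ^+ 2 = 1 + (A ^+ 2 + B ^+ 2) * (o1 ^+ 2 + o2 ^+ 2).
  by rewrite o_unit mulr1 addrA.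
by field; rewrite gt_eqF.
Qed.

(** The second variation as an inequality between the second fundamental form
    of the surface, divided by [nu], and the Hessian of the barrier. *)
Let variation (v : 'rV[R]_2) (t0 t1 : R) : v *m F = hlift t0 t1 ->
  exists K : R, inner gE p (v *m S *m F) (hlift t0 t1) = nu * K /\
   K + (hess x y t0 t1 - 2 * tau * (b_x x y * t0 + b_y x y * t1)
      * (b_y x y * t0 - b_x x y * t1)) <= 0.
Proof.
move=> hv; have [_ [T1 [h1 h2]]] := line_variation v.
move: h1 h2; rewrite hv => h1 h2.
exists (db x y (T1 0 0) (T1 0 1) (T1 0 2)
    + kinetic kappa tau x y (b_x x y / l ^+ 2) (b_y x y / l ^+ 2) 1
       t0 t1 (vert kappa tau p (hlift t0 t1))).
split; last first.
  apply: le_trans h1; rewrite le_eqVlt; apply/orP; left; apply/eqP.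
  have e : ctc x y (hlift t0 t1 0 0) (hlift t0 t1 0 1) (hlift t0 t1 0 2) =
    - (b_x x y * t0 + b_y x y * t1) by exact: ctc_lift.
  rewrite e ctc_lift !mxE /= -/l; by ring.
rewrite h2 N0 N1 -/nu -[X in kinetic _ _ _ _ _ _ X](mulr1 nu) kineticZ !mxE /=.
rewrite [RHS]mulrDr; congr (_ + _).
rewrite inner_Ekt -/nu N0 N1 -/x -/y -/l /dbarrier -/l /vert.
by field; rewrite gt_eqF.
Qed.

Let J t0 t1 := hess x y t0 t1 - 2 * tau * (b_x x y * t0 + b_y x y * t1)
      * (b_y x y * t0 - b_x x y * t1).

(** The Hessian term in the frame, with components [u] and [v]. *)
Let JE (u v : R) : J ((u * o1 - v * o2) / l) ((u * o2 + v * o1) / l) =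
  2 * tau * (1 + kappa * s ^+ 2) / m * (u * v) + m * g1 s * u ^+ 2
  - kappa * s * g s * (u ^+ 2 + v ^+ 2)
  - eps * ((1 - kappa * P) / (1 + P) * (u ^+ 2 + v ^+ 2) - (u * q1 + v * q2) ^+ 2)
  - 2 * tau * (A * u + B * v) * (B * u - A * v).
Proof.
rewrite /J /barrier_hess; set t0 := (u * o1 - v * o2) / l; set t1 := _ / l.
have o_mul (r : R) : r = r * (o1 ^+ 2 + o2 ^+ 2) by rewrite o_unit mulr1.
have -> : linear_fn_x kappa a b c x y * t0 + linear_fn_y kappa a b c x y * t1 = u * rt.
  by rewrite sxE syE [RHS]o_mul /t0 /t1; field; rewrite gt_eqF.
have -> : linear_fn_x kappa a b c x y * t1 - linear_fn_y kappa a b c x y * t0 = v * rt.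
  by rewrite sxE syE [RHS]o_mul /t0 /t1; field; rewrite gt_eqF.
have -> : lam x y ^+ 2 * (t0 ^+ 2 + t1 ^+ 2) = u ^+ 2 + v ^+ 2.
  by rewrite -/l [RHS]o_mul /t0 /t1; field; rewrite gt_eqF.
have -> : lam x y ^+ 2 * (x * t0 + y * t1) / (1 + radial kappa x y) = u * q1 + v * q2.
  rewrite -/l -/P /q1 /q2 /t0 /t1; by field; rewrite (gt_eqF P1) (gt_eqF l0).
have -> : b_x x y * t0 + b_y x y * t1 = A * u + B * v.
  by rewrite bxE byE [RHS]o_mul /t0 /t1; field; rewrite gt_eqF.
have -> : b_y x y * t0 - b_x x y * t1 = B * u - A * v.
  by rewrite bxE byE [RHS]o_mul /t0 /t1; field; rewrite gt_eqF.
rewrite -/s -/P -/m -rt2; by field; rewrite (gt_eqF P1) (gt_eqF rt0).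
Qed.

(** The inverse Gram matrix of [E1], [E2] times its determinant [W^2] is the
    identity plus the square of [(B, - A)], so that a trace over the tangent
    plane, multiplied by [W^2], is the sum of three values, at [E1], [E2] and
    [B E1 - A E2].  Summing the three second variations gives [graph_curvature
    <= 2 |H| W^3], against the choice of the profile. *)
Lemma barrier_no_max : False.
Proof.
have [v1 hv1] := lifts (o1 / l) (o2 / l); have [v2 hv2] := lifts (- o2 / l) (o1 / l).
have lift3 : hlift ((B * o1 + A * o2) / l) ((B * o2 - A * o1) / l) = B *: E1 - A *: E2.
  apply/rowP => -[[|[|[|//]]] hj]; rewrite !mxE /=; by field; rewrite gt_eqF.
have hv3 : (B *: v1 - A *: v2) *m F = hlift ((B * o1 + A * o2) / l) ((B * o2 - A * o1) / l).
  by rewrite lift3 mulmxBl -!scalemxAl hv1 hv2.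
have [K1 [k1 j1]] := variation hv1; have [K2 [k2 j2]] := variation hv2.
have [K3 [k3 j3]] := variation hv3.
pose V : 'M[R]_2 := \matrix_i (if i == 0 then v1 else v2).
have V0 : row 0 V = v1 by rewrite rowK.
have V1 : row 1 V = v2 by rewrite rowK.
(* The horizontal parts of [E1] and [E2] are orthogonal; [Q] is the inverse
   of their matrix. *)
have uV : V \in unitmx.
  pose Q : 'M[R]_(3, 2) := \matrix_(i, j)
    (if j == 0 then [:: l * o1; l * o2; 0]`_i
     else [:: - (l * o2); l * o1; 0]`_i).
  have VFQ : V *m (F *m Q) = 1%:M.
    rewrite mulmxA; apply/row_matrixP => i; rewrite !row_mul.
    apply/rowP => j; rewrite [LHS]mxE sum3 [RHS]mxE [RHS]mxE.
    have : i = 0 \/ i = 1 by case: i => -[|[|//]] hi; [left|right]; exact/val_inj.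
    case=> ->; rewrite ?V0 ?V1 ?hv1 ?hv2 /hlift !mxE /=; case: j => -[|[|//]] hj /=;
      rewrite -?o_unit; by field; rewrite gt_eqF.
  by have [] := mulmx1_unit VFQ.
(* [M] is the shape operator in the basis [E1], [E2]. *)
pose M := V *m S *m invmx V.
have VS : V *m S = M *m V by rewrite /M mulmxKV.
have trM : M 0 0 + M 1 1 = 2 * H.
  have <- : \tr M = M 0 0 + M 1 1 by rewrite /mxtrace sum2.
  by rewrite /M mxtrace_mulC mulmxA mulVmx // mul1mx -hH; field.
have rows i : row i V *m S *m F = M i 0 *: E1 + M i 1 *: E2.
  have rM j : row i M 0 j = M i j by rewrite mxE.
  rewrite -row_mul VS row_mul (mulmx_sum_row (row i M)) sum2 /= !rM V0 V1 mulmxDl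
    -!scalemxAl hv1 hv2.
  by [].
have s1 := rows 0; have s2 := rows 1; rewrite V0 in s1; rewrite V1 in s2.
have cl r t u v z : inner gE p (r *: u + t *: v) z = r * inner gE p u z +
  t * inner gE p v z.
  by rewrite inner_addl !inner_scalel.
have cr r t u v z : inner gE p z (r *: u + t *: v) = r * inner gE p z u +
  t * inner gE p z v.
  by rewrite inner_addr !inner_scaler.
have {}k1 : M 0 0 * (1 + A ^+ 2) + M 0 1 * (A * B) = nu * K1.
  by rewrite -k1 s1 cl i11 i21.
have {}k2 : M 1 0 * (A * B) + M 1 1 * (1 + B ^+ 2) = nu * K2.
  by rewrite -k2 s2 cl i12 i22.
have {}k3 : B * (B * (M 0 0 * (1 + A ^+ 2) + M 0 1 * (A * B))
        + - A * (M 0 0 * (A * B) + M 0 1 * (1 + B ^+ 2)))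
    + - A * (B * (M 1 0 * (1 + A ^+ 2) + M 1 1 * (A * B))
        + - A * (M 1 0 * (A * B) + M 1 1 * (1 + B ^+ 2))) = nu * K3.
  rewrite -k3 lift3 !mulmxBl -!scalemxAl s1 s2 -!scaleNr.
  by rewrite (cl B) (cr B) (cr B) !cl i11 i12 i21 i22.
pose W := Num.sqrt (1 + A ^+ 2 + B ^+ 2).
have W2 : W ^+ 2 = 1 + A ^+ 2 + B ^+ 2.
  by rewrite sqr_sqrtr // !addr_ge0 // sqr_ge0.
have kk : nu * (K1 + K2 + K3) = 2 * H * W ^+ 2.
  rewrite 2!mulrDr -k1 -k2 -k3 -trM W2; by ring.
have W0 : 0 <= W by rewrite sqrtr_ge0.
have nuW : (`|nu| * W) = 1.
  apply/eqP; rewrite -(@eqrXn2 _ 2) ?mulr_ge0 // expr1n exprMn real_normK ?num_real //.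
  by rewrite W2 nu2.
have Ksum : K1 + K2 + K3 = nu * (2 * H * W ^+ 2) * W ^+ 2.
  rewrite -kk mulrA -expr2 mulrAC -[LHS]mul1r W2; congr (_ * _).
  by rewrite nu2.
have := barrier_curvature hb (hC hu0) (radial_ge0 hd) (q1 := q1) (q2 := q2).
have hq : (q1 ^+ 2 + q2 ^+ 2) * (1 + P) ^+ 2 = 2 * P - kappa * P ^+ 2.
  rewrite -(radial_grad_norm hd) -/l.
  have -> : x ^+ 2 + y ^+ 2 = (x ^+ 2 + y ^+ 2) * (o1 ^+ 2 +
    o2 ^+ 2) by rewrite o_unit mulr1.
  by rewrite /q1 /q2; field; rewrite gt_eqF.
move=> /(_ hq); cbv zeta; rewrite -/p -/x -/y -/s -/m -/rt -/P -/A -/B -/W.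
set Q := graph_curvature _ _ _ _ _.
have Jsum : J (o1 / l) (o2 / l) + J (- o2 / l) (o1 / l)
    + J ((B * o1 + A * o2) / l) ((B * o2 - A * o1) / l) = Q.
  have e1 : o1 / l = (1 * o1 - 0 * o2) / l by rewrite mul1r mul0r subr0.
  have e2 : o2 / l = (1 * o2 + 0 * o1) / l by rewrite mul1r mul0r addr0.
  have e3 : - o2 / l = (0 * o1 - 1 * o2) / l by rewrite mul1r mul0r sub0r.
  have e4 : o1 / l = (0 * o2 + 1 * o1) / l by rewrite mul1r mul0r add0r.
  have e5 : (B * o1 + A * o2) / l = (B * o1 - (- A) * o2) / l by rewrite mulNr opprK.
  have e6 : (B * o2 - A * o1) / l = (B * o2 + (- A) * o1) / l by rewrite mulNr.
  rewrite {1}e1 e2 e3 e4 e5 e6 !JE /Q /graph_curvature -rt2.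
  by field; rewrite gt_eqF // gt_eqF.
rewrite ltNge => /negP; apply.
have : Q <= - (K1 + K2 + K3).
  by rewrite -Jsum; move: j1 j2 j3; rewrite -!/(J _ _); lra.
move=> /le_trans; apply; rewrite Ksum.
apply: le_trans (ler_norm _) _; rewrite normrN !normrM.
rewrite (ger0_norm (ler0n R 2)) !(ger0_norm W0) le_eqVlt; apply/orP; left; apply/eqP.
transitivity (2 * `|H| * W ^+ 3 * (`|nu| * W)); first by ring.
by rewrite nuW mulr1.
Qed.

End NoMaximum.

(** * Horizontal geodesics *)

Section HorizontalGeodesic.
Context {R : realType} (kappa tau : R) (c : R -> 'rV[R]_3).
Hypothesis hk : kappa <= 0.
Local Notation gE := (Ekt_metric kappa tau).
Hypothesis hgeo : geodesic (Ekt kappa) gE c.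
Hypothesis hhor : forall t, inner gE (c t) (derive1 c t) (Ekt_xi R) = 0.

Let c1 := derive1 c.
Let c2 := derive1n 2 c.
Let x (t : R) : R := c t 0 0.
Let y (t : R) : R := c t 0 1.
Let v0 (t : R) : R := c1 t 0 0.
Let v1 (t : R) : R := c1 t 0 1.
Local Notation lam := (conf kappa).

Let hd (t : R) : in_base kappa (x t) (y t).
Proof. by have [h _ _ _] := hgeo; exact: h. Qed.

Let dc (t : R) : is_derive t 1 c (c1 t).
Proof.
have [_ h _ _] := hgeo; have := h 0%N t; rewrite /= => d.
by apply: DeriveDef; [exact: d|rewrite /c1 derive1E].
Qed.

Let dc1 (t : R) : is_derive t 1 c1 (c2 t).
Proof.
have [_ h _ _] := hgeo; have := h 1%N t; rewrite /= => d.
by apply: DeriveDef; [exact: d|rewrite /c2 /= derive1E].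
Qed.

Let eta0 (t : R) : vert kappa tau (c t) (c1 t) = 0.
Proof.
have := hhor t; rewrite inner_Ekt -/(c1 t) /Ekt_xi !mxE /= !(mulr0, add0r).
have -> : vert kappa tau (c t) (delta_mx 0 2) = 1.
  by rewrite /vert /contact !mxE /=; ring.
by rewrite mulr1.
Qed.

Let speed (t : R) : R := lam (x t) (y t) ^+ 2 * (v0 t ^+ 2 + v1 t ^+ 2).

Section LinearFunction.
Variables a b e : R.
Let u (t : R) : R := linear_fn kappa a b e (x t) (y t).
Let sx (t : R) : R := linear_fn_x kappa a b e (x t) (y t).
Let sy (t : R) : R := linear_fn_y kappa a b e (x t) (y t).
Let u1 (t : R) : R := sx t * v0 t + sy t * v1 t.

Lemma der_linear (t : R) : is_derive t 1 u (u1 t).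
Proof.
have d0 := der_coord 0 (dc t); have d1 := der_coord 1 (dc t).
exact: (der_linear_fn d0 d1 (hd t) a b e).
Qed.

(** The Hessian of [linear_fn], evaluated along a horizontal geodesic by
    pairing the geodesic equation with the horizontal lift [n] of its
    gradient. *)
Lemma der2_linear (t : R) : is_derive t 1 u1 (- kappa * speed t * u t).
Proof.
have d0 := der_coord 0 (dc t); have d1 := der_coord 1 (dc t).
have e0 := der_coord 0 (dc1 t); have e1 := der_coord 1 (dc1 t).
have dsx := der_linear_fn_x d0 d1 (hd t) a b e;
  have dsy := der_linear_fn_y d0 d1 (hd t) a b e.
have l0 := conf_gt0 (hd t).
pose n : 'rV[R]_3 := \row_j [:: sx t / lam (x t) (y t) ^+ 2; sy t / lam (x t) (y t) ^+ 2;
  - (tau * lam (x t) (y t) * (y t * (sx t / lam (x t) (y t) ^+ 2)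
       - x t * (sy t / lam (x t) (y t) ^+ 2)))]`_j.
have etan : vert kappa tau (c t) n = 0.
  by rewrite /vert /contact !mxE /= -/(x t) -/(y t); ring.
have [_ _ _ /(_ t) hg] := hgeo.
have : inner gE (c t) (derive1n 2 c t +
  connection gE (c t) (derive1 c t) (derive1 c t)) n = 0.
  by rewrite hg /inner !mul0mx mxE.
rewrite inner_addl inner_connection; last by have [h _ _ _] := hgeo; exact: h.
rewrite inner_Ekt /dmetric etan (eta0 t) -/(c1 t) -/(c2 t) -/(x t) -/(y t) !mxE /=.
rewrite -/(v0 t) -/(v1 t) /dlam => hI.
notypeclasses refine (is_derive_eq _ _); first by rewrite /u1 /sx /sy /v0 /v1; der.
cbv beta zeta; rewrite -/(sx t) -/(sy t) -/(u t) -/(v0 t) -/(v1 t) -/(x t) -/(y t).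
rewrite /speed.
move: hI l0; move: (lam _ _) (c2 t 0 0) (c2 t 0 1) => l x2 y2 hI l0.
have {}hI : sx t * x2 + sy t * y2 = l * kappa * (x t * v0 t +
  y t * v1 t) * (sx t * v0 t + sy t * v1 t)
  - l * kappa / 2 * (x t * sx t + y t * sy t) * (v0 t ^+ 2 + v1 t ^+ 2).
  apply/eqP; rewrite -subr_eq0 -hI; apply/eqP; by field; rewrite gt_eqF.
transitivity (sx t * x2 + sy t * y2 - kappa * u t * l ^+ 2 * (v0 t ^+ 2 + v1 t ^+ 2)
  - l * kappa / 2 * (2 * (x t * v0 t + y t * v1 t) * (sx t * v0 t + sy t * v1 t)
    - (x t * sx t + y t * sy t) * (v0 t ^+ 2 + v1 t ^+ 2))); first by field.
rewrite hI; by field.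
Qed.

End LinearFunction.

(** The linear function [u] that vanishes at the initial point together with
    its derivative along the geodesic, and the positive linear function [L],
    solve the same linear equation of second order: their Wronskian vanishes,
    so that [u / L] is constant, hence zero. *)
Lemma horizontal_geodesic_level : exists a b e,
  [/\ a ^+ 2 + b ^+ 2 + kappa * e ^+ 2 = 1,
      forall t, linear_fn kappa a b e (x t) (y t) = 0 &
      forall w, is_height kappa tau a b e w ->
        forall t, c t 0 2 + w (x t) (y t) = c 0 0 2 + w (x 0) (y 0)].
Proof.
have l0 := conf_gt0 (hd 0); have lE := confE (hd 0).
have vv : 0 < v0 0 ^+ 2 + v1 0 ^+ 2.
  rewrite lt_neqAle addr_ge0 ?sqr_ge0 // andbT eq_sym.
  have [_ _ /(_ 0) + _] := hgeo; apply: contraNneq => /eqP.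
  rewrite paddr_eq0 ?sqr_ge0 // !expf_eq0 /= => /andP[/eqP h0 /eqP h1].
  have := eta0 0; rewrite /vert /contact -/(v0 0) -/(v1 0) h0 h1 => h2.
  apply/eqP; apply: rV3P; rewrite ?mxE //.
  by move: h2; rewrite !mulr0 subrr mulr0 addr0.
(* [(a, b, e)] is determined up to sign by the vanishing of the function
   and of its derivative along the geodesic at time 0, and by a gradient of
   length 1. *)
pose mu := (Num.sqrt (v0 0 ^+ 2 + v1 0 ^+ 2))^-1.
have mu2 : mu ^+ 2 * (v0 0 ^+ 2 + v1 0 ^+ 2) = 1.
  by rewrite exprVn sqr_sqrtr ?mulVf ?gt_eqF // ltW.
pose e := lam (x 0) (y 0) * (mu * (v1 0 * x 0 - v0 0 * y 0)).
pose a := kappa / 2 * e * x 0 - mu * v1 0.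
pose b := kappa / 2 * e * y 0 + mu * v0 0.
have eE : e * (1 + kappa / 4 * (x 0 ^+ 2 + y 0 ^+ 2)) = mu * (v1 0 * x 0 - v0 0 * y 0).
  by rewrite /e mulrAC lE mul1r.
have norm1 : a ^+ 2 + b ^+ 2 + kappa * e ^+ 2 = 1.
  transitivity (kappa * e * (e * (1 + kappa / 4 * (x 0 ^+ 2 + y 0 ^+ 2))
     - mu * (v1 0 * x 0 - v0 0 * y 0)) + mu ^+ 2 * (v0 0 ^+ 2 + v1 0 ^+ 2)).
    by rewrite /a /b; field.
  by rewrite eE subrr mulr0 add0r.
have s0 : linear_fn kappa a b e (x 0) (y 0) = 0.
  transitivity (lam (x 0) (y 0) * (e * (1 + kappa / 4 * (x 0 ^+ 2 + y 0 ^+ 2))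
     - mu * (v1 0 * x 0 - v0 0 * y 0))); last by rewrite eE subrr mulr0.
  by rewrite /linear_fn /a /b; field.
have ds0 : linear_fn_x kappa a b e (x 0) (y 0) * v0 0 +
  linear_fn_y kappa a b e (x 0) (y 0) * v1 0 = 0.
  by rewrite /linear_fn_x /linear_fn_y s0 /a /b; field.
pose u (t : R) : R := linear_fn kappa a b e (x t) (y t).
pose u1 (t : R) : R := linear_fn_x kappa a b e (x t) (y t) * v0 t +
  linear_fn_y kappa a b e (x t) (y t) * v1 t.
pose L (t : R) : R := linear_fn kappa 0 0 1 (x t) (y t).
pose L1 (t : R) : R := linear_fn_x kappa 0 0 1 (x t) (y t) * v0 t +
  linear_fn_y kappa 0 0 1 (x t) (y t) * v1 t.
have du (t : R) : is_derive t 1 u (u1 t) := der_linear a b e t.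
have du1 (t : R) : is_derive t 1 u1 _ := der2_linear a b e t.
have dL (t : R) : is_derive t 1 L (L1 t) := der_linear 0 0 1 t.
have dL1 (t : R) : is_derive t 1 L1 _ := der2_linear 0 0 1 t.
have L0 t : 0 < L t.
  rewrite /L /linear_fn !mul0r !add0r mul1r mulr_gt0 ?conf_gt0 //.
  rewrite subr_gt0 (le_lt_trans _ ltr01) // mulr_le0_ge0 ?addr_ge0 ?sqr_ge0 //.
  by rewrite mulr_le0_ge0.
have wr t : u1 t * L t - u t * L1 t = 0.
  have d (s : R) : is_derive s 1 (fun r => u1 r * L r - u r * L1 r) 0.
    have h1 := du s; have h2 := du1 s; have h3 := dL s; have h4 := dL1 s.
    notypeclasses refine (is_derive_eq _ _); first by der.
    by cbv beta; rewrite -/(u s) -/(L s); ring.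
  by rewrite (der_cst0 d t) /u1 /u ds0 s0 !mul0r subrr.
have u0 t : u t = 0.
  have d (s : R) : is_derive s 1 (fun r => u r * (L r)^-1) 0.
    have h1 := du s; have h2 : is_derive s 1 (fun r => (L r)^-1) (- (L s) ^- 2 * L1 s).
      by notypeclasses refine (derV _ (dL s)); rewrite gt_eqF.
    notypeclasses refine (is_derive_eq _ _); first by der.
    cbv beta; transitivity ((u1 s * L s - u s * L1 s) / L s ^+ 2); last by rewrite wr mul0r.
    by field; rewrite gt_eqF.
  have := der_cst0 d t; rewrite {2}/u s0 mul0r => /eqP.
  by rewrite mulf_eq0 invr_eq0 (gt_eqF (L0 t)) orbF => /eqP.
exists a, b, e; split=> // w hw t.
have d (s : R) : is_derive s 1 (fun r => c r 0 2 + w (x r) (y r)) 0.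
  have d0 := der_coord 0 (dc s); have d1 := der_coord 1 (dc s).
  have d2 := der_coord 2 (dc s); have h := height_der hw d0 d1 (hd s).
  notypeclasses refine (is_derive_eq _ _); first by rewrite /x /y; der.
  have := eta0 s; rewrite /vert /contact => h0.
  rewrite /height_form /twist -/(x s) -/(y s) -/(u s) u0 !(mulr0, mul0r) addr0.
  by rewrite -/(x s) -/(y s) in h0; rewrite h0.
exact: (der_cst0 d t).
Qed.

End HorizontalGeodesic.

(** * Points at bounded distance from the geodesic *)

Section Lipschitz.
Context {R : realType} (kappa tau a b e : R) (w : R -> R -> R).
Hypothesis hk : kappa <= 0.
Hypothesis hn : a ^+ 2 + b ^+ 2 + kappa * e ^+ 2 = 1.
Hypothesis hw : is_height kappa tau a b e w.
Local Notation gE := (Ekt_metric kappa tau).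

Definition height_at (p : 'rV[R]_3) : R := p 0 2 + w (p 0 0) (p 0 1).
Definition offset_at (p : 'rV[R]_3) : R := linear_fn kappa a b e (p 0 0) (p 0 1).
(** The logarithm makes up for the growth of the gradients: those of
    [offset_at] and [height_at] grow linearly with [offset_at]. *)
Definition log_offset (p : 'rV[R]_3) : R := ln (1 + offset_at p ^+ 2 + height_at p ^+ 2).

Let K : R := 2 + 2 * (1 - kappa) + 2 * `|tau|.

Lemma ler_abs_sqr (r s : R) : 0 <= s -> r ^+ 2 <= s ^+ 2 -> `|r| <= s.
Proof. by move=> s0 h; rewrite -ler_sqr ?nnegrE // real_normK ?num_real. Qed.

Let arg_gt0 p : 0 < 1 + offset_at p ^+ 2 + height_at p ^+ 2.
Proof. by rewrite -addrA ltr_pwDl // addr_ge0 ?sqr_ge0. Qed.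

(** The gradients of [offset_at] and [height_at] have lengths at most [1 + (1
    - kappa) |s|] and [1 + 2 |tau| |s|], where [s] is the offset; [K] is what
    the logarithm leaves of them. *)
Lemma log_offset_lipschitz (c : R -> 'rV[R]_3) (v : 'rV[R]_3) (t : R) :
  Ekt kappa (c t) -> is_derive t 1 c v ->
  exists2 d : R, is_derive t 1 (fun s => log_offset (c s)) d &
    `|d| <= K * Num.sqrt (inner gE (c t) v v).
Proof.
move=> hE hc.
have d0 := der_coord 0 hc; have d1 := der_coord 1 hc; have d2 := der_coord 2 hc.
have ds := der_linear_fn d0 d1 hE a b e; have dw := height_der hw d0 d1 hE.
have l0 := conf_gt0 hE; have m0 := twist_denom_gt0 a b e hk (c t 0 0) (c t 0 1).
have grad := linear_fn_grad_norm hE hn.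
pose h1 : R := v 0 2 + height_form kappa tau a b e (c t 0 0) (c t 0 1) (v 0 0) (v 0 1).
pose s1 := linear_fn_x kappa a b e (c t 0 0) (c t 0 1) * v 0 0 +
  linear_fn_y kappa a b e (c t 0 0) (c t 0 1) * v 0 1.
have dh : is_derive t 1 (fun r => height_at (c r)) h1 := derD d2 dw.
have dsq : is_derive t 1 (fun r => offset_at (c r)) s1 := ds.
exists ((1 + offset_at (c t) ^+ 2 + height_at (c t) ^+ 2)^-1 *
   (2 * offset_at (c t) * s1 + 2 * height_at (c t) * h1)).
  notypeclasses refine (is_derive_eq _ _).
    rewrite /log_offset; notypeclasses refine (@der_comp _ (@ln R)
      (fun s => 1 + offset_at (c s) ^+ 2 + height_at (c s) ^+ 2) _ _ _ _ _).
      exact: (is_derive1_ln (arg_gt0 (c t))).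
    by der.
  by cbv beta; rewrite add0r.
pose D := Num.sqrt (inner gE (c t) v v).
pose q := conf kappa (c t 0 0) (c t 0 1) ^+ 2 * (v 0 0 ^+ 2 + v 0 1 ^+ 2).
have q0 : 0 <= q by rewrite mulr_ge0 ?addr_ge0 ?sqr_ge0.
have D2 : D ^+ 2 = q + vert kappa tau (c t) v ^+ 2.
  rewrite sqr_sqrtr inner_Ekt -!expr2 //.
  by rewrite addr_ge0 ?sqr_ge0.
have D0 : 0 <= D by rewrite sqrtr_ge0.
have qD : q <= D ^+ 2 by rewrite D2 lerDl sqr_ge0.
have etaD : `|vert kappa tau (c t) v| <= D by apply: ler_abs_sqr => //; rewrite D2 lerDr.
rewrite -/D.
set s := offset_at (c t); set z := height_at (c t).
set m := 1 - kappa * linear_fn kappa a b e (c t 0 0) (c t 0 1) ^+ 2 in m0 grad.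
pose r := linear_fn_x kappa a b e (c t 0 0) (c t 0 1) * v 0 1 -
  linear_fn_y kappa a b e (c t 0 0) (c t 0 1) * v 0 0.
have sr : s1 ^+ 2 + r ^+ 2 = m * q.
  transitivity ((linear_fn_x kappa a b e (c t 0 0) (c t 0 1) ^+ 2 +
    linear_fn_y kappa a b e (c t 0 0) (c t 0 1) ^+ 2)
     * (v 0 0 ^+ 2 + v 0 1 ^+ 2)); first by rewrite /s1 /r; ring.
  by rewrite grad /q; ring.
have mE : m = 1 - kappa * s ^+ 2 by [].
have bs1 : `|s1| <= (1 + (1 - kappa) * `|s|) * D.
  apply: ler_abs_sqr; first by rewrite mulr_ge0 // addr_ge0 // mulr_ge0 // subr_ge0
    (le_trans hk).
  apply: (@le_trans _ _ (m * D ^+ 2)).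
    apply: (@le_trans _ _ (m * q)); first by rewrite -sr lerDl sqr_ge0.
    by rewrite ler_wpM2l // ltW.
  rewrite exprMn ler_wpM2r ?sqr_ge0 // mE -[s ^+ 2]real_normK ?num_real //.
  have := hk; have := normr_ge0 s; move: `|s| => S S0 hk'.
  by have := mulr_ge0 S0 S0; nra.
have bt : `|twist kappa tau a b e (c t 0 0) (c t 0 1) * r| <= 2 * `|tau| * `|s| * D.
  apply: ler_abs_sqr; first by rewrite !mulr_ge0.
  rewrite [leRHS](_ : _ = 2 ^+ 2 * tau ^+ 2 * s ^+ 2 * D ^+ 2); last first.
    by rewrite -(real_normK (num_real tau)) -(real_normK (num_real s)); ring.
  have m1 : 1 <= m by rewrite mE lerDl oppr_ge0 mulr_le0_ge0 // sqr_ge0.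
  rewrite exprMn; have -> : twist kappa tau a b e (c t 0 0) (c t 0 1) ^+ 2 * r ^+ 2 =
      2 ^+ 2 * tau ^+ 2 * s ^+ 2 * (r ^+ 2 / m ^+ 2).
    rewrite /twist -/m -/(offset_at (c t)) -/s; by field; rewrite gt_eqF.
  apply: ler_wpM2l; first by rewrite -!exprMn sqr_ge0.
  rewrite ler_pdivrMr ?exprn_gt0 //.
  apply: (@le_trans _ _ (m * q)); first by rewrite -sr lerDr sqr_ge0.
  by rewrite mulrC expr2 mulrA ler_wpM2r ?(ltW m0) // (le_trans qD) // ler_peMr // sqr_ge0.
have h1E : h1 = vert kappa tau (c t) v + twist kappa tau a b e (c t 0 0) (c t 0 1) * r.
  by rewrite /h1 /height_form /vert /contact /r; ring.
have bh1 : `|h1| <= (1 + 2 * `|tau| * `|s|) * D.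
  rewrite h1E [leRHS]mulrDl mul1r; apply: (le_trans (ler_normD _ _)).
  exact: lerD.
(* The offset and the height are only needed as real numbers from here on. *)
have u0 := arg_gt0 (c t); rewrite -/s -/z in u0 *; clearbody s z.
rewrite normrM normfV (gtr0_norm u0) ler_pdivrMl //.
apply: (le_trans (ler_normD _ _)); rewrite !normrM (ger0_norm (ler0n R 2)).
apply: (@le_trans _ _ ((2 * `|s| * (1 + (1 - kappa) * `|s|) + 2 * `|z| * (1 +
  2 * `|tau| * `|s|)) * D)).
  rewrite [leRHS]mulrDl -!(mulrA _ _ D); apply: lerD; apply: ler_wpM2l => //;
    by rewrite mulr_ge0.
rewrite mulrA; apply: ler_wpM2r => //.
rewrite -[s ^+ 2]real_normK ?num_real // -[z ^+ 2]real_normK ?num_real //.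
have := normr_ge0 s; have := normr_ge0 z; have := normr_ge0 tau; have k1 := hk.
rewrite /K; move: `|s| `|z| `|tau| => S Z T T0 Z0 S0.
have := sqr_ge0 (S - 1); have := sqr_ge0 (Z - 1); have := mulr_ge0 T0 (sqr_ge0 (S - Z)).
have kS := mulr_le0_ge0 k1 (sqr_ge0 S); have kZ := mulr_le0_ge0 k1 (sqr_ge0 Z).
have TS := mulr_ge0 T0 (sqr_ge0 S); have TZ := mulr_ge0 T0 (sqr_ge0 Z).
have := sqr_ge0 S; have := sqr_ge0 Z.
by lra.
Qed.

End Lipschitz.

Section PathBound.
Context {R : realType}.

(** [f] plus [K] times the integral of [sp] is nondecreasing. *)
Lemma integral_growth (f sp : R -> R) (K : R) :
  (forall t : R, t \in `[0, 1]%R -> {for t, continuous sp}) ->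
  (forall t : R, t \in `[0, 1]%R -> exists2 d : R, is_derive t 1 f d & `|d| <= K * sp t) ->
  f 0 <= f 1 + K * (\int[lebesgue_measure]_(t in `[0, 1]) sp t)%R.
Proof.
move=> csp df.
have wsp : {within `[0, 1], continuous sp}.
  by apply: continuous_in_subspaceT => t; rewrite inE => /csp.
have isp : lebesgue_measure.-integrable `[0%R, 1%R] (EFin \o sp).
  by apply: continuous_compact_integrable => //; exact: segment_compact.
pose L (s : R) : R := parameterized_integral lebesgue_measure 0 s sp.
pose h (s : R) : R := K * L s + f s.
have L0 : L 0 = 0 by rewrite /L /parameterized_integral set_itv1 Rintegral_set1.
have cL : {within `[0, 1], continuous L} := parameterized_integral_continuous ler01 isp.
have cf : {within `[0, 1], continuous f}.
  apply: continuous_in_subspaceT => t; rewrite inE => /df[d hd _].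
  exact: der_continuous hd.
have ch : {within `[0, 1], continuous h}.
  by move=> t; apply: cvgD; [apply: cvgM; [exact: cvg_cst|exact: cL]|exact: cf].
have dh (t : R) : t \in `]0, 1[%R -> is_derive t 1 h (K * sp t + 'D_1 f t).
  rewrite in_itv /= => /andP[t0 t1].
  have t01 : t \in `[0, 1]%R by rewrite in_itv /= !ltW.
  have [dL eL] := continuous_FTC1_closed t1 isp t0 (csp t t01).
  have hL : is_derive t 1 L (sp t).
    by apply: DeriveDef; [exact: dL|rewrite -derive1E].
  have [d hd _] := df t t01.
  notypeclasses refine (is_derive_eq (derD (derM (derC t K) hL) hd) _).
  by rewrite mul0r add0r (@derive_val _ _ _ _ _ _ _ hd).
have [t ht] := MVT ltr01 dh ch.
rewrite subr0 mulr1 /h L0 mulr0 add0r => e.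
have : 0 <= K * sp t + 'D_1 f t.
  have t01 : t \in `[0, 1]%R.
    by move: ht; rewrite !in_itv /= => /andP[t0 t1]; rewrite !ltW.
  have [d hd] := df t t01; rewrite (@derive_val _ _ _ _ _ _ _ hd) ler_norml; lra.
by rewrite -e subr_ge0 addrC.
Qed.

Lemma cont_coord (T : topologicalType) (c : T -> 'rV[R]_3) (t : T) (j : 'I_3) :
  {for t, continuous c} -> {for t, continuous (fun s => c s 0 j : R)}.
Proof.
by move=> hc; apply: (continuous_comp hc (@coord_continuous _ _ _ 0 j (c t))).
Qed.

Section Ekt.
Variables (kappa tau a b e : R) (w : R -> R -> R).
Hypothesis hk : kappa <= 0.
Hypothesis hn : a ^+ 2 + b ^+ 2 + kappa * e ^+ 2 = 1.
Hypothesis hw : is_height kappa tau a b e w.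
Local Notation gE := (Ekt_metric kappa tau).
Local Notation Psi := (log_offset kappa a b e w).
Let K : R := 2 + 2 * (1 - kappa) + 2 * `|tau|.

Lemma arc_bound (c : R -> 'rV[R]_3) : C1_arc (Ekt kappa) c ->
  Psi (c 0) <= Psi (c 1) + K * arc_length gE c.
Proof.
move=> hc.
apply: (@integral_growth (fun t => Psi (c t))
  (fun t => Num.sqrt (inner gE (c t) (derive1 c t) (derive1 c t)))) => t ht.
- have [hE dc cc] := hc t ht.
  have hc1 : is_derive t 1 c (derive1 c t).
    by apply: DeriveDef; [exact: dc|rewrite derive1E].
  have c0 := der_continuous (der_coord 0 hc1); have c1 := der_continuous (der_coord 1 hc1).
  have v0 := cont_coord (j := 0) cc; have v1 := cont_coord (j := 1) cc;
    have v2 := cont_coord (j := 2) cc.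
  have cl : {for t, continuous (fun s => conf kappa (c s 0 0) (c s 0 1))}.
    by rewrite /conf; apply: contV; [rewrite gt_eqF|cont].
  apply: (@cont_comp _ _ Num.sqrt (fun s => inner gE (c s) (derive1 c s) (derive1 c s))).
    exact: sqrt_continuous.
  have -> : (fun s => inner gE (c s) (derive1 c s) (derive1 c s)) = fun s =>
    conf kappa (c s 0 0) (c s 0 1) ^+ 2 * (derive1 c s 0 0 * derive1 c s 0 0 +
      derive1 c s 0 1 * derive1 c s 0 1)
    + vert kappa tau (c s) (derive1 c s) * vert kappa tau (c s) (derive1 c s).
    by apply/funext => s; rewrite inner_Ekt.
  by rewrite /vert /contact; cont.
- have [hE dc cc] := hc t ht.
  apply: log_offset_lipschitz hk hn hw _ _ _ hE _.
  by apply: DeriveDef; [exact: dc|rewrite derive1E].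
Qed.

Lemma path_bound p q l : path_of_length (Ekt kappa) gE p q l -> Psi p <= Psi q + K * l.
Proof.
elim=> [r _|c r m hc _ IH]; first by rewrite mulr0 addr0.
apply: (le_trans (arc_bound hc)).
by rewrite mulrDr [K * arc_length _ _ + _]addrC addrA lerD2r.
Qed.

Lemma dist_bound (A : set 'rV[R]_3) p (C : R) :
  (forall q, A q -> Psi q = 0) -> (dist_to_set (Ekt kappa) gE A p <= C%:E)%E ->
  Psi p <= K * (C + 1).
Proof.
move=> hA hp.
have K0 : 0 <= K by rewrite /K !addr_ge0 // mulr_ge0 // subr_ge0 (le_trans hk).
have : (dist_to_set (Ekt kappa) gE A p < (C + 1)%:E)%E.
  by rewrite (le_lt_trans hp) // lte_fin ltrDl.
move=> /ereal_inf_lt[_ [q Aq <-]] /ereal_inf_lt[_ [l hl <-]].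
rewrite lte_fin => lC; have := path_bound hl; rewrite (hA q Aq) add0r.
by move=> /le_trans; apply; rewrite ler_wpM2l // ltW.
Qed.

Lemma log_offset_bound p (C : R) : Psi p <= C ->
  `|offset_at kappa a b e p| <= expR C /\ `|height_at w p| <= expR C.
Proof.
move=> h; set s := offset_at _ _ _ _ _; set z := height_at _ _.
have h0 : 0 < 1 + s ^+ 2 + z ^+ 2.
  by rewrite -addrA ltr_pwDl // addr_ge0 ?sqr_ge0.
have : 1 + s ^+ 2 + z ^+ 2 <= expR C by rewrite -(lnK h0) ler_expR.
have := expR_gt0 C; move: (expR C) => E E0 hE.
have s2 := sqr_ge0 s; have z2 := sqr_ge0 z.
have E1 : 1 <= E by lra.
have EE : E <= E ^+ 2 by rewrite expr2 ler_peMr // ltW.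
by split; apply: ler_abs_sqr; lra.
Qed.

End Ekt.
End PathBound.

(** * Compactness and the main theorem *)

Section Compactness.
Context {R : realType} (kappa tau : R).
Hypothesis hk : kappa <= 0.

Lemma height_shift a b e w (k : R) : is_height kappa tau a b e w ->
  is_height kappa tau a b e (fun x y => w x y + k).
Proof.
move=> [h1 h2 h3]; split.
- move=> x y t x1 y1 hx hy hd; have h := h1 _ _ _ _ _ hx hy hd.
  by notypeclasses refine (is_derive_eq (derD h (derC t k)) _); rewrite addr0.
- by move=> T X Y p hd hX hY; have h := h2 _ _ _ _ hd hX hY; cont.
- move=> r; have [M hM] := h3 r; exists (M + `|k|) => x y hd hr.
  by rewrite (le_trans (ler_normD _ _)) // lerD // hM.
Qed.

Lemma compact_disc_slab (r Z : R) :
  compact [set p : 'rV[R]_3 | p 0 0 ^+ 2 + p 0 1 ^+ 2 <= r /\ `|p 0 2| <= Z].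
Proof.
pose B := 1 + `|r| + `|Z|.
have cB : compact [set v : 'rV[R]_3 | forall i, v ord0 i \in `[- B, B]%R].
  apply: (@rV_compact _ _ (fun=> [set` `[- B, B]%R])) => _; exact: segment_compact.
apply: (subclosed_compact _ cB); last first.
  move=> p /= [h1 h2] i; rewrite in_itv /= -ler_norml.
  have sq (s : R) : s ^+ 2 <= r -> `|s| <= B.
    move=> hs; apply: ler_abs_sqr; first by rewrite /B !addr_ge0.
    have r0 : 0 <= r := le_trans (sqr_ge0 s) hs.
    rewrite /B (ger0_norm r0); have := normr_ge0 Z; move: `|Z| => z z0.
    have := mulr_ge0 r0 z0; have := sqr_ge0 (r + z); nra.
  case: i => -[|[|[|//]]] hi.
  - rewrite (_ : Ordinal hi = 0); last exact/val_inj.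
    by apply: sq; apply: le_trans h1; rewrite lerDl sqr_ge0.
  - rewrite (_ : Ordinal hi = 1); last exact/val_inj.
    by apply: sq; apply: le_trans h1; rewrite lerDr sqr_ge0.
  - rewrite (_ : Ordinal hi = 2); last exact/val_inj.
    apply: (le_trans h2); apply: (le_trans (ler_norm Z)).
    by rewrite /B lerDr addr_ge0.
have cc (j : 'I_3) (p : 'rV[R]_3) : {for p, continuous (fun q : 'rV[R]_3 => q 0 j : R)}.
  apply: (@cont_coord _ _ (fun q : 'rV[R]_3 => q)); exact: cvg_id.
have -> : [set p : 'rV[R]_3 | p 0 0 ^+ 2 + p 0 1 ^+ 2 <= r /\ `|p 0 2| <= Z] =
  (fun p : 'rV[R]_3 => p 0 0 ^+ 2 + p 0 1 ^+ 2 : R) @^-1` [set s | s <= r] `&`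
  (fun p : 'rV[R]_3 => `|p 0 2| : R) @^-1` [set s | s <= Z] by [].
apply: closedI; apply: preimage_closed; try exact: closed_le.
- move=> p _; have h0 := cc 0 p; have h1 := cc 1 p.
  have : {for p, continuous (fun p : 'rV[R]_3 => p 0 0 ^+ 2 + p 0 1 ^+ 2 : R)} by cont.
  exact.
- move=> p _; exact: (continuous_comp (cc 2 p) (@norm_continuous _ _ _)).
Qed.

Lemma immersion_continuous (S : smoothSurface R) (phi : S -> 'rV[R]_3) (x : S) :
  immersion (Ekt kappa) phi -> {for x, continuous phi}.
Proof.
move=> [_ himm]; have [d hd dx] := surface_cover x.
have [[_ hs] _] := himm d hd; have [oD _ inv cmap _] := surface_charts hd.
have cX : {for chart_map d x, continuous (phi \o chart_inv d)}.
  apply: differentiable_continuous; apply: (hs [::]); by exists x.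
have h : ((phi \o chart_inv d) \o chart_map d) y @[y --> x] --> phi x.
  by rewrite -[in X in _ --> X](inv x dx); exact: continuous_comp (cmap x dx) cX.
apply: cvg_trans h; apply: near_eq_cvg.
have : nbhs x (chart_dom d) by apply: open_nbhs_nbhs.
by apply: filterS => y hy /=; rewrite inv.
Qed.

End Compactness.

Section BarrierOnSurface.
Context {R : realType} (kappa tau a b e H C eps : R) (w : R -> R -> R) (G g g1 : R -> R).
Hypothesis hk : kappa <= 0.
Hypothesis hw : is_height kappa tau a b e w.
Hypothesis hb : is_barrier_profile kappa tau C H eps G g g1.
Local Notation f := (barrier_at kappa a b e eps w G).

Lemma barrier_continuous (T : topologicalType) (phi : T -> 'rV[R]_3) (x : T) :
  Ekt kappa (phi x) -> `|offset_at kappa a b e (phi x)| <= C ->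
  {for x, continuous phi} -> {for x, continuous (f \o phi)}.
Proof.
move=> hE hC hphi.
have c0 := cont_coord (j := 0) hphi; have c1 := cont_coord (j := 1) hphi.
have c2 := cont_coord (j := 2) hphi.
have cw := height_cont hw hE c0 c1.
have cl : {for x, continuous (fun s => conf kappa (phi s 0 0) (phi s 0 1))}.
  by rewrite /conf; apply: contV; [rewrite gt_eqF|cont].
have cs : {for x, continuous (fun s => linear_fn kappa a b e (phi s 0 0) (phi s 0 1))}.
  by rewrite /linear_fn; cont.
have cG := cont_comp (f := G)
  (X := fun s => linear_fn kappa a b e (phi s 0 0) (phi s 0 1)) (p :=
    x) (der_continuous (barrier_der hb hC)) cs.
have p0 := radial_ge0 hE.
have cp : {for x, continuous (fun s => 1 + radial kappa (phi s 0 0) (phi s 0 1))}.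
  by rewrite /radial; cont.
have p1 : 0 < 1 + radial kappa (phi x 0 0) (phi x 0 1) by lra.
have cln := cont_comp (f := @ln R)
  (X := fun s => 1 + radial kappa (phi s 0 0) (phi s 0 1)) (p :=
    x) (der_continuous (is_derive1_ln p1)) cp.
have : {for x, continuous (fun s => phi s 0 2 + w (phi s 0 0) (phi s 0 1)
   + G (linear_fn kappa a b e (phi s 0 0) (phi s 0 1))
   - eps * ln (1 + radial kappa (phi s 0 0) (phi s 0 1)))} by cont.
exact.
Qed.

(** [G(s)] and the height are bounded there, so that a lower bound on the
    barrier bounds [ln (1 + P)], hence keeps the base point in a compact disc;
    on it the height controls [z]. *)
Lemma barrier_sublevel (E A : R) : exists r Z : R,
  0 < 1 + kappa / 4 * r /\
  forall p, Ekt kappa p -> `|offset_at kappa a b e p| <= C -> `|height_at w p| <= E ->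
    A <= f p -> p 0 0 ^+ 2 + p 0 1 ^+ 2 <= r /\ `|p 0 2| <= Z.
Proof.
have [M hM] := barrier_bounded hb; have eps0 := barrier_eps_gt0 hb.
pose B := expR ((E + M - A) / eps); have B0 : 0 < B := expR_gt0 _.
have d0 : 0 < 1 - kappa * B / 2 by have := mulr_le0_ge0 hk (ltW B0); lra.
pose r := 2 * B / (1 - kappa * B / 2).
have [Mw hMw] := height_bounded hw r.
exists r, (E + Mw); split.
  have -> : 1 + kappa / 4 * r = (1 - kappa * B / 2)^-1.
    have d1 : 0 < 2 - kappa * B by lra.
    by rewrite /r; field; rewrite (gt_eqF d1).
  by rewrite invr_gt0.
move=> p hE hC hh hA; have p0 := radial_ge0 hE.
have hp : radial kappa (p 0 0) (p 0 1) <= B.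
  have p1 : 0 < 1 + radial kappa (p 0 0) (p 0 1) by lra.
  suff : 1 + radial kappa (p 0 0) (p 0 1) <= B by lra.
  rewrite -[leLHS]lnK // ler_expR ler_pdivlMr // mulrC.
  have := hM _ hC; move: hh hA; rewrite /barrier_at /barrier /height_at /offset_at.
  move: (p 0 2 + _) (G _) (ln _) => h G' q.
  by rewrite !ler_norml => /andP[_ h1] h2 /andP[_ h3]; lra.
have hr : p 0 0 ^+ 2 + p 0 1 ^+ 2 <= r.
  rewrite /r ler_pdivlMr //; move: hp; rewrite /radial /conf.
  have := hE; rewrite /Ekt /= /Ekt_denom; move: (p 0 0 ^+ 2 + _) => s hs.
  rewrite ler_pdivrMr // mulrC ler_pdivrMr //; lra.
split=> //; have := hMw _ _ hE hr; move: hh; rewrite /height_at.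
by rewrite !ler_norml; move: (w _ _) => u /andP[h1 h2] /andP[h3 h4]; apply/andP; split; lra.
Qed.

End BarrierOnSurface.

Unset Implicit Arguments.

Theorem corollary4p2 (R : realType) (kappa tau H : R) (Gamma : set 'rV[R]_3)
    (hGamma : horizontal_geodesic kappa tau Gamma)
    (hH : 4 * H ^+ 2 + kappa <= 0) :
  ~ exists (S : smoothSurface R) (phi : S -> 'rV[R]_3),
      properly_immersed_H_surface kappa tau H phi /\
      at_bounded_distance (Ekt kappa) (Ekt_metric kappa tau) Gamma phi.
Proof.
move=> [S [phi [[himm hprop hcmc] [C0 hdist]]]].
have hk : kappa <= 0 by have := sqr_ge0 H; lra.
have [c [hgeo hhor GammaE]] := hGamma.
have [a [b [e [hn hsig hz]]]] := horizontal_geodesic_level hk hgeo hhor.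
have [w0 hw0] := exists_height tau hk hn.
pose z0 := c 0 0 2 + w0 (c 0 0 0) (c 0 0 1).
pose w x y := w0 x y + - z0.
have hw : is_height kappa tau a b e w := height_shift (- z0) hw0.
have Psi0 q : Gamma q -> log_offset kappa a b e w q = 0.
  rewrite GammaE => -[t _ <-]; rewrite /log_offset /offset_at /height_at /w hsig.
  by rewrite addrA hz // subrr expr0n /= !addr0 ln1.
pose K := 2 + 2 * (1 - kappa) + 2 * `|tau|.
pose C := expR (K * (C0 + 1)); have C_gt0 : 0 < C := expR_gt0 _.
have hbd x : `|offset_at kappa a b e (phi x)| <= C /\ `|height_at w (phi x)| <= C.
  exact: log_offset_bound (dist_bound hk hn hw Psi0 (hdist x)).
have [eps [G [g [g1 hb]]]] := exists_barrier_profile tau hk C_gt0 hH.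
pose f := barrier_at kappa a b e eps w G.
have [x0 _] := surface_nonempty S.
have hE := himm.1.
have [r [Z [r0 hK]]] := barrier_sublevel hk hw hb C (f (phi x0)).
(* [D] contains the superlevel set of the barrier through an arbitrary
   point of the surface. *)
pose D := [set p : 'rV[R]_3 | p 0 0 ^+ 2 + p 0 1 ^+ 2 <= r /\ `|p 0 2| <= Z].
have DE : D `<=` Ekt kappa.
  move=> p [hp _]; rewrite /Ekt /= /Ekt_denom (lt_le_trans r0) // lerD2l.
  by rewrite ler_wnM2l // pmulr_lle0 // invr_gt0.
have inD x : f (phi x0) <= f (phi x) -> D (phi x).
  by have [h1 h2] := hbd x; exact: hK.
have cD : compact (phi @^-1` D) := hprop D (@compact_disc_slab R r Z) DE.
have cf : {within phi @^-1` D, continuous (f \o phi)}.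
  apply: continuous_in_subspaceT => x _.
  by apply: (barrier_continuous hw hb) => //;
    [case: (hbd x)|exact: immersion_continuous himm].
have [|xm _ hm] := compact_EVT_max _ cD cf; first by exists x0; exact: inD.
have hmax x : f (phi x) <= f (phi xm).
  have [/inD h|/ltW h] := leP (f (phi x0)) (f (phi x)).
    by apply: hm; rewrite inE.
  by apply: (le_trans h); apply: hm; rewrite inE; exact: inD.
have [d hd dx] := surface_cover xm.
have [hs hfree] := himm.2 d hd; have [N hN hA] := hcmc d hd.
have [_ _ inv _ _] := surface_charts hd.
have hu0 : chart_cod d (chart_map d xm) by exists xm.
have [A hS hAH] := hA _ hu0.
apply: (@barrier_no_max _ kappa tau a b e H C eps w G g g1 hk hn hw hb _ _ _ _ _
  hs _ hN hu0 (hfree _ hu0) hS hAH).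
- by move=> u _; exact: hE.
- by move=> u _; case: (hbd (chart_inv d u)).
- by move=> u _; rewrite /= inv //; exact: hmax.
Qed.
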